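(* For any integer $k\ge 3$ and constant $\tfrac{1}{k}<\eta\le 1$, there exists an $\alpha>0$ such that for all sufficiently large $n\in \mathbb{N}$, any $n$-vertex graph $G$ with $\delta(G)\ge \eta n$ and $\alpha(G)\le \alpha n$ contains an $\eta$-quasiperfect $C_k$-tiling, where $C_k$ denotes the cycle with $k$ vertices.
   Context: Graphs are finite and simple; $\delta(G)$ is the minimum degree and $\alpha(G)$ is the independence number of $G$. An $F$-tiling in $G$ is a collection of vertex-disjoint copies of $F$ in $G$ (not necessarily induced). For $\eta\in(0,1]$ and a $k$-vertex graph $F$, an $F$-tiling in $G$ is $\eta$-quasiperfect if it covers all but at most $\lfloor 1/\eta\rfloor (k-1)$ vertices of $G$. *)

(* Defs.v *)
From mathcomp Require Import all_boot all_order all_algebra.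
From mathcomp Require Import reals.

Set Implicit Arguments.
Unset Strict Implicit.
Unset Printing Implicit Defensive.

Import Order.TTheory GRing.Theory Num.Theory.
Local Open Scope ring_scope.

Record sgraph := SGraph {
  vertex :> finType;
  adj : rel vertex;
  adj_sym : symmetric adj;
  adj_irrefl : irreflexive adj }.

Definition degree (G : sgraph) (x : G) : nat := #|[set y : G | adj x y]|.

(* Every degree is smaller than #|G|, so the default value #|G| of the iterated
   minimum does not affect the result, except on the graph without vertices. *)
Definition min_degree (G : sgraph) : nat := \big[minn/#|G|]_(x : G) degree x.

Definition independent (G : sgraph) (A : {set G}) : bool :=
  [forall x in A, forall y in A, ~~ adj x y].

Definition independence_number (G : sgraph) : nat :=
  (\max_(A : {set G} | independent A) #|A|)%N.

(* The conjunct i != j matters only for k = 1, where it removes the loop. *)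
Definition cycle_adj (k : nat) : rel 'I_k :=
  fun i j => (i != j) && ((i.+1 %% k == j)%N || (j.+1 %% k == i)%N).

Lemma cycle_adj_sym k : symmetric (@cycle_adj k).
Proof. by move=> i j; rewrite /cycle_adj eq_sym orbC. Qed.

Lemma cycle_adj_irrefl k : irreflexive (@cycle_adj k).
Proof. by move=> i; rewrite /cycle_adj eqxx. Qed.

Definition cycle_graph (k : nat) : sgraph :=
  SGraph (@cycle_adj_sym k) (@cycle_adj_irrefl k).

(* A not necessarily induced copy of F in G is given by an injective
   adjacency-preserving map f from F to G: its vertices are the f x, and its
   edges are the pairs (f x, f y) with x and y adjacent in F. *)
Definition is_copy (F G : sgraph) (f : {ffun F -> G}) : Prop :=
  injective f /\ (forall x y : F, adj x y -> adj (f x) (f y)).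

Definition copy_vertices (F G : sgraph) (f : {ffun F -> G}) : {set G} :=
  [set f x | x : F].

Definition is_tiling (F G : sgraph) (t : {set {ffun F -> G}}) : Prop :=
  (forall f, f \in t -> is_copy f) /\
  (forall f g, f \in t -> g \in t -> f != g ->
     [disjoint copy_vertices f & copy_vertices g]).

Definition covered (F G : sgraph) (t : {set {ffun F -> G}}) : {set G} :=
  \bigcup_(f in t) copy_vertices f.

Definition quasiperfect (R : realType) (eta : R) (F G : sgraph)
    (t : {set {ffun F -> G}}) : Prop :=
  #|~: covered t|%:Z <= Num.floor (1 / eta) * (#|F|%:Z - 1).

(* Main.v *)
(** The independence number is so small that every neighbourhood of linear size
contains a path with [k - 1] vertices, which the centre closes to a [k]-cycle.

Call [u] and [v] reachable if robustly many bounded sets become tileable both by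
adding [u] and by adding [v]; vertices with linearly many common neighbours are
reachable. As [m + 1 = floor (1 / eta) + 1] neighbourhoods cannot be almost
disjoint, an extremal choice of at most [m] pairwise unreachable vertices splits
almost all of [G] into at most [m] cores whose vertices are pairwise reachable.
Every core contains [k]-cycles robustly: otherwise it sends many edges to another
core, and the cycles of types [(1, k - 1)] and [(2, k - 2)] on the two cores would
link their centres. Hence every [k]-subset of a core has linearly many disjoint
absorbers.

Linearly many disjoint absorbers (rather than polynomially many absorbers) suffice
by Montgomery's method: a bounded-degree bipartite template that is robustly
matchable turns them into one set that absorbs any [h] vertices out of [2 * h]
prescribed ones in the core. The rest of the graph is tiled up to a small set [L]
by a maximal tiling; each vertex of [L] is covered by a cycle through prescribed
vertices, and each core then absorbs what remains of its block up to at most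
[k - 1] vertices. *)

Require Import Defs.
From mathcomp Require Import all_boot all_order all_algebra.
From mathcomp Require Import reals zify ring lra.

Set Implicit Arguments.
Unset Strict Implicit.
Unset Printing Implicit Defensive.

(** * Finite sets *)

(** A small independence number yields one path at a time, not a positive proportion of all
    candidates. Robustness is therefore always stated as: for every forbidden set [W] of bounded
    size there is a suitable object disjoint from [W]. This form feeds greedy choices directly. Its
    price is that composing links shrinks the admissible [W] and enlarges the connecting set, so
    reachability is not an equivalence relation; the extremal choice runs over a ladder of levels
    and compares unreachability at one level with maximality at the level before. The hypothesis
    [eta > 1/k] is what makes [L] small. In a maximum packing a cycle has at most one vertex with
    many neighbours in [L], so [L] receives at most about [|L| * n / k] edges, against
    [|L| * delta]; this leaves room only for an [L] of the order of the independence number. The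
    [k - 1] vertices lost in a core are a divisibility loss: the size of a block modulo [k] is not
    controlled. Vertices with few neighbours among the prescribed ones could not be rescued from
    [L]; they are covered beforehand. *)

Section FiniteSets.
Variable T : finType.
Implicit Types A B W Z : {set T}.

Lemma exists_subset_card A s :
  s <= #|A| -> exists2 B : {set T}, B \subset A & #|B| = s.
Proof.
move=> sA; exists [set x in take s (enum A)].
  by apply/subsetP => x; rewrite inE => /mem_take; rewrite mem_enum.
rewrite cardsE (card_uniqP _) ?take_uniq ?enum_uniq // size_take -cardE.
by case: ltngtP sA => //  ->.
Qed.

Lemma leq_cardD A B : #|A| <= #|A :\: B| + #|B|.
Proof. by rewrite -(cardsID B A) addnC leq_add2l subset_leq_card // subsetIr. Qed.

Lemma leq_cardsU A B : #|A :|: B| <= #|A| + #|B|.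
Proof. by rewrite cardsU leq_subr. Qed.

Lemma leq_cards1U x A : #|x |: A| <= #|A|.+1.
Proof. by apply: leq_trans (leq_cardsU _ _) _; rewrite cards1. Qed.

Lemma leq_card_bigcup (J : finType) (D : {set J}) (F : J -> {set T}) t :
  (forall j, j \in D -> #|F j| <= t) -> #|\bigcup_(j in D) F j| <= #|D| * t.
Proof.
move=> Ft; rewrite -sum_nat_const.
elim/big_rec2: _ => [|j s S jD IH]; first by rewrite cards0.
by apply: leq_trans (leq_cardsU _ _) _; rewrite leq_add // Ft.
Qed.

Lemma disjointU1s x A W :
  [disjoint x |: A & W] = (x \notin W) && [disjoint A & W].
Proof.
by rewrite -!setI_eq0 setIUl setU_eq0 setI_eq0 disjoints1.
Qed.

Lemma disjointsUr A B W : [disjoint W & A :|: B] = [disjoint W & A] && [disjoint W & B].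
Proof. by rewrite -!setI_eq0 setIUr setU_eq0. Qed.

Lemma disjointsUl A B W : [disjoint A :|: B & W] = [disjoint A & W] && [disjoint B & W].
Proof. by rewrite -!setI_eq0 setIUl setU_eq0. Qed.

Lemma disjointP A B : reflect (forall x, x \in A -> x \in B -> False) [disjoint A & B].
Proof.
rewrite disjoint_subset; apply: (iffP subsetP) => H x xA.
  by move=> xB; have := H x xA; rewrite inE xB.
by rewrite inE; apply/negP => xB; exact: H xA xB.
Qed.

Lemma disjointF A B x : [disjoint A & B] -> x \in A -> x \in B -> False.
Proof. by move/disjointP => H; exact: H. Qed.

Lemma disjoint_bigcupl (J : finType) (D : {set J}) (F : J -> {set T}) A :
  (forall j, j \in D -> [disjoint F j & A]) -> [disjoint \bigcup_(j in D) F j & A].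
Proof.
move=> H; apply/disjointP => x /bigcupP[j jD xF] xA.
exact: disjointF (H j jD) xF xA.
Qed.

Lemma set_size_ind (J : finType) (P : {set J} -> Prop) :
  P set0 -> (forall (x : J) (D : {set J}), x \notin D -> P D -> P (x |: D)) -> forall D, P D.
Proof.
move=> P0 PU D; have [n] := ubnP #|D|; elim: n D => // n IH D leD.
have [->//|[x xD]] := set_0Vmem D.
rewrite -(setD1K xD); apply: PU; first by rewrite !inE eqxx.
by apply: IH; rewrite (cardsD1 x) xD in leD.
Qed.

(** A new set meets the union of the earlier ones in at most [#|D| * g] points; the square bounds
    the sum of these losses crudely. Used backwards: too many large sets in [G] force two with a
    large intersection. *)
Lemma bonferroni (J : finType) (D : {set J}) (F : J -> {set T}) (g : nat) :
  (forall i j, i \in D -> j \in D -> i != j -> #|F i :&: F j| <= g) ->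
  \sum_(i in D) #|F i| <= #|\bigcup_(i in D) F i| + #|D| ^ 2 * g.
Proof.
elim/set_size_ind: D => [|x D xD IH] H; first by rewrite big_set0.
rewrite !big_setU1 //= cardsU1 xD.
have := cardsUI (F x) (\bigcup_(i in D) F i).
have : #|F x :&: \bigcup_(i in D) F i| <= #|D| * g.
  rewrite big_distrr /=; apply: leq_card_bigcup => j jD.
  apply: H; rewrite ?inE ?eqxx ?jD ?orbT //.
  by apply: contraNneq xD => ->.
have : \sum_(i in D) #|F i| <= #|\bigcup_(i in D) F i| + #|D| ^ 2 * g.
  by apply: IH => i j iD jD; apply: H; rewrite inE ?iD ?jD orbT.
set a := \sum_(_ in _) _; set b := #|_ :|: _|; nia.
Qed.

(** The set to avoid is [W0] with the members already chosen; it stays below [cap] because each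
    member costs at most [t]. *)
Lemma greedy_family (J : finType) (D : {set J}) (P : J -> {set T} -> Prop)
    (t cap : nat) (W0 : {set T}) :
  (forall j W, j \in D -> #|W| <= cap ->
     exists S, [/\ P j S, #|S| <= t & [disjoint S & W]]) ->
  #|W0| + #|D| * t <= cap ->
  exists S : J -> {set T},
    [/\ forall j, j \in D -> P j (S j),
        forall j, j \in D -> #|S j| <= t,
        forall j, j \in D -> [disjoint S j & W0] &
        forall i j, i \in D -> j \in D -> i != j -> [disjoint S i & S j]].
Proof.
move=> H; elim/set_size_ind: D H => [|x D xD IH] H.
  by move=> _; exists (fun=> set0); split=> j; rewrite inE.
rewrite cardsU1 xD mulnDl mul1n => capD.
have [||S [SP St SW SS]] := IH.
- by move=> j W jD; apply: H; rewrite inE jD orbT.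
- by lia.
have [||Sx [Px tx]] := H x (W0 :|: \bigcup_(j in D) S j).
- exact: setU11.
- apply: leq_trans (leq_cardsU _ _) _.
  have := leq_card_bigcup St; lia.
rewrite disjointsUr => /andP[xW xS].
have xSj j : j \in D -> [disjoint Sx & S j].
  by move=> jD; apply: disjointWr xS; exact: bigcup_sup.
have nx j : j \in D -> (j == x) = false by move=> jD; apply/negbTE; apply: contraNneq xD => <-.
exists (fun j => if j == x then Sx else S j); split=> [j|j|j|i j];
  rewrite !inE.
- by case: eqP => [->|_]//=; apply: SP.
- by case: eqP => [->|_]//=; apply: St.
- by case: eqP => [->|_]//=; apply: SW.
case: (eqVneq i x) => [->|_] /=; case: (eqVneq j x) => [->|_] //=.
- by move=> _ jD _; apply: xSj.
- by move=> iD _ _; rewrite disjoint_sym; apply: xSj.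
exact: SS.
Qed.

End FiniteSets.

Ltac set_ac :=
  apply/setP => ?; rewrite !inE;
  repeat match goal with
  | |- context [?y \in ?A] => case: (y \in A)
  | |- context [?y == ?b] => case: (y == b)
  end; reflexivity.

Ltac only_leq :=
  repeat match goal with
  | H : is_true ?b |- _ =>
    lazymatch b with leq _ _ => fail | _ => clear H end
  end.
Ltac slia := only_leq; lia.

(** * Paths and cycles *)

Section Cycles.
Variable G : sgraph.
Implicit Types (x u v : G) (A B S W Z : {set G}).

Definition nbr x : {set G} := [set y | adj x y].

Lemma in_nbr x y : (y \in nbr x) = adj x y.
Proof. by rewrite inE. Qed.

(* Peel off a maximal independent set: a path in the rest extends into it. *)
Lemma exists_path (a p : nat) Z :
  (forall I : {set G}, independent I -> #|I| <= a) -> p * a < #|Z| ->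
  exists x s, [/\ path (@adj G) x s, uniq (x :: s), size s = p & {subset x :: s <= Z}].
Proof.
move=> Ha; elim: p Z => [|p IH] Z.
  rewrite mul0n => /card_gt0P[x xZ]; exists x, [::].
  by split=> // y; rewrite inE => /eqP->.
move=> ltZ.
have [I /maxsetP[/andP[IZ indI] maxI]] :
    exists I, maxset (fun I : {set G} => (I \subset Z) && independent I) I.
  have [|I mI _] := @maxset_exists _ (fun I : {set G} => (I \subset Z) && independent I) set0.
    by rewrite sub0set; apply/forall_inP => y; rewrite inE.
  by exists I.
have [|x [s [ps us ss sZ]]] := IH (Z :\: I).
  have := leq_cardD Z I; have := Ha _ indI; nia.
have xZ : x \in Z :\: I by apply: sZ; rewrite inE eqxx.
have [y yI xy] : exists2 y, y \in I & adj x y.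
  case: (boolP [exists y in I, adj x y]) => [/exists_inP //|/exists_inPn nI].
  exfalso; move: xZ; rewrite inE => /andP[/negP xI xZ].
  apply: xI; rewrite -(maxI (x |: I)) ?subsetUr ?inE ?eqxx //.
  apply/andP; split; first by rewrite subUset sub1set xZ.
  apply/forall_inP => u /setU1P[->|uI]; apply/forall_inP => v /setU1P[->|vI].
  - by rewrite adj_irrefl.
  - exact: nI.
  - by rewrite adj_sym; exact: nI.
  - by have /forall_inP/(_ u uI)/forall_inP/(_ v vI) := indI.
exists y, (x :: s); split=> //=.
- by rewrite adj_sym xy.
- rewrite -/(uniq (x :: s)) us andbT; apply/negP => /sZ; by rewrite inE yI.
- by rewrite ss.
move=> z; rewrite inE => /orP[/eqP->|]; first exact: (subsetP IZ).
by move/sZ; rewrite inE => /andP[].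
Qed.

Variable k : nat.

Definition kcycle B : bool :=
  [exists f : {ffun cycle_graph k -> G},
    [&& injectiveb f, [forall i, forall j, adj i j ==> adj (f i) (f j)]
      & copy_vertices f == B]].

Lemma kcycleP B :
  reflect (exists f : {ffun cycle_graph k -> G}, is_copy f /\ copy_vertices f = B)
          (kcycle B).
Proof.
apply: (iffP existsP) => -[f].
  case/and3P => /injectiveP injf /forallP fadj /eqP fB; exists f; split=> //.
  by split=> // i j; move/implyP: (forallP (fadj i) j).
case=> [[injf fadj] fB]; exists f; apply/and3P; split; [exact/injectiveP| |exact/eqP].
by apply/forallP => i; apply/forallP => j; apply/implyP; apply: fadj.
Qed.

Lemma card_kcycle B : kcycle B -> #|B| = k.
Proof.
case/kcycleP => f [[injf _] <-].
by rewrite card_imset // card_ord.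
Qed.

Lemma kcycle_seq (s : seq G) :
  uniq s -> size s = k -> cycle (@adj G) s -> kcycle [set x in s].
Proof.
case: s => [|x p] us sk cs.
  (* An empty cycle means [k = 0], where the index type is empty. *)
  apply/kcycleP; rewrite /= in sk; 
  have f0 : {ffun cycle_graph k -> G} by apply: (finfun (fun i => _)) => -[i]; rewrite -sk.
  exists f0; split; first by split => -[i hi]; exfalso; move: hi; rewrite -sk.
  by apply/setP => y; rewrite !inE; apply/imsetP => -[[i hi]]; exfalso; move: hi; rewrite -sk.
set s := x :: p in us sk cs *.
pose f : {ffun cycle_graph k -> G} := [ffun i : 'I_k => nth x s i].
(* [cycle] is a path along [rcons p x], whose entry past the last index is [x] again: this is the
   wrap-around of the indices modulo [k]. *)
have step (i j : nat) : i < k -> i.+1 %% k = j -> adj (nth x s i) (nth x s j).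
  move=> ik ij; have /(pathP x) := cs => /(_ i).
  rewrite size_rcons -[(size p).+1]/(size s) sk => /(_ ik).
  rewrite -rcons_cons !nth_rcons -/s sk ik.
  suff -> : (if i < size p then nth x p i else if i == size p then x else x) = nth x s j by [].
  have sp : (size p).+1 = k by rewrite -sk.
  move: ik; rewrite -sp ltnS leq_eqVlt => /orP[/eqP e|lt].
    by rewrite -ij e ltnn eqxx sp modnn.
  by rewrite lt -ij modn_small // -sp.
apply/kcycleP; exists f; split; first split.
- move=> i j; rewrite !ffunE => /eqP; rewrite nth_uniq ?sk ?ltn_ord //.
  by move/eqP/val_inj.
- move=> i j; rewrite !ffunE => /andP[_ /orP[]/eqP]; first exact/step/ltn_ord.
  by rewrite adj_sym; exact/step/ltn_ord.
apply/setP => y; rewrite inE; apply/imsetP/idP => [[i _ ->]|].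
  by rewrite ffunE mem_nth // sk ltn_ord.
move=> ys; have iy : index y s < k by rewrite -sk index_mem.
by exists (Ordinal iy) => //; rewrite ffunE /= nth_index.
Qed.

(** The set is a path on [k - 1] vertices, whose ends are joined by every [u] adjacent to all of it.
    The path is fixed before [u], so the same [B] serves several centres; this is the source of
    reachability. *)
Lemma exists_star (a : nat) Z :
  2 < k -> (forall I : {set G}, independent I -> #|I| <= a) -> (k - 2) * a < #|Z| ->
  exists B, [/\ B \subset Z, #|B| = k.-1 &
    forall u, B \subset nbr u -> kcycle (u |: B)].
Proof.
move=> k3 Ha /(exists_path Ha)[x [s [ps us ss sZ]]].
exists [set y in x :: s]; split.
- by apply/subsetP => y; rewrite inE; exact: sZ.
- by rewrite cardsE (card_uniqP us) /= ss; lia.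
move=> u /subsetP Bu.
have -> : u |: [set y in x :: s] = [set y in u :: x :: s].
  by apply/setP => y; rewrite !inE.
apply: kcycle_seq => //.
- rewrite cons_uniq us andbT; apply/negP => us'.
  by have := Bu u; rewrite !inE adj_irrefl => /(_ us').
- by rewrite /= ss; lia.
have := Bu (last x s); rewrite !inE -in_cons mem_last => /(_ isT) ul.
have := Bu x; rewrite !inE eqxx => /(_ isT) ux.
by rewrite /= rcons_path ps ux adj_sym ul.
Qed.

End Cycles.

(** * Tileable sets and reachability *)

Section Tileable.
Variables (G : sgraph) (k : nat).
Implicit Types (x u v : G) (A B S W Z : {set G}).

(** Only the vertex sets of the cycles are recorded; embeddings are chosen at the end, in
    [tileable_tiling]. *)
Definition tileable S : bool :=
  [exists P : {set {set G}}, partition P S && [forall B in P, kcycle k B]].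

Lemma tileableP S :
  reflect (exists2 P : {set {set G}}, partition P S & forall B, B \in P -> kcycle k B)
          (tileable S).
Proof.
apply: (iffP existsP) => -[P].
  by case/andP => pP /forall_inP H; exists P.
by move=> pP H; exists P; rewrite pP; apply/forall_inP.
Qed.

Lemma tileable_tiling S : tileable S ->
  exists2 t : {set {ffun cycle_graph k -> G}}, is_tiling t & covered t = S.
Proof.
case/tileableP => P /and3P[/eqP covP trivP _] cP.
pose good B (f : {ffun cycle_graph k -> G}) :=
  [&& injectiveb f, [forall i, forall j, adj i j ==> adj (f i) (f j)]
    & copy_vertices f == B].
have goodP B : B \in P -> exists f, good B f by move/cP/existsP.
(* [pick] keeps one embedding per block: two embeddings with the same vertex set would not be
   disjoint. *)
pose t := [set f : {ffun cycle_graph k -> G} |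
  [exists B in P, [pick f | good B f] == Some f]].
have tP f : f \in t -> exists2 B, B \in P & ([pick f | good B f] = Some f) /\ good B f.
  rewrite inE => /exists_inP[B BP /eqP e]; exists B => //; split=> //.
  by move: e; case: pickP => // g gB [<-].
have gcv B f : good B f -> copy_vertices f = B by case/and3P => _ _ /eqP.
exists t; first split.
- move=> f /tP[B BP [_ /and3P[/injectiveP injf fadj _]]]; split=> // i j.
  by move/forallP: fadj => /(_ i)/forallP/(_ j)/implyP.
- move=> f g /tP[B BP [eB gB]] /tP[C CP [eC gC]] fg.
  rewrite (gcv _ _ gB) (gcv _ _ gC); apply: (trivIsetP trivP) => //.
  apply: contraNneq fg => eBC; move: eB; rewrite eBC eC.
  by case=> ->.
rewrite -covP /covered /cover; apply/setP => x; apply/bigcupP/bigcupP => -[].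
  by move=> f /tP[B BP [_ /gcv ->]] xB; exists B.
move=> B BP xB; have := goodP B BP.
case e: [pick f | good B f] => [f|]; last first.
  by move: e; case: pickP => // H _ [f]; rewrite H.
have gf : good B f by move: e; case: pickP => // g gB [<-].
move=> _; exists f; last by rewrite (gcv _ _ gf).
by rewrite inE; apply/exists_inP; exists B; rewrite ?e.
Qed.

Lemma tileable0 : tileable set0.
Proof.
apply/tileableP; exists set0; last by move=> B; rewrite inE.
by apply/and3P; split; rewrite ?inE // /cover ?big_set0 //; apply/trivIsetP => A B; rewrite inE.
Qed.

Lemma tileable_kcycle B : 0 < k -> kcycle k B -> tileable B.
Proof.
move=> k0 cB; apply/tileableP; exists [set B]; last by move=> C; rewrite inE => /eqP->.
apply/and3P; split.
- by rewrite /cover big_set1.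
- by apply/trivIsetP => A C; rewrite !inE => /eqP-> /eqP->; rewrite eqxx.
by rewrite inE eq_sym -card_gt0 (card_kcycle cB).
Qed.

Lemma tileableU A B : [disjoint A & B] -> tileable A -> tileable B -> tileable (A :|: B).
Proof.
move=> dAB /tileableP[P /and3P[/eqP cP tP P0] kP] /tileableP[Q /and3P[/eqP cQ tQ Q0] kQ].
apply/tileableP; exists (P :|: Q); last by move=> C; rewrite inE => /orP[/kP|/kQ].
have sP C : C \in P -> C \subset A by move=> CP; rewrite -cP; exact: bigcup_sup.
have sQ C : C \in Q -> C \subset B by move=> CQ; rewrite -cQ; exact: bigcup_sup.
apply/and3P; split.
- rewrite -cP -cQ /cover; apply/eqP/setP => x; rewrite inE.
  apply/bigcupP/orP => [[C]|[]/bigcupP[C CP xC]].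
  + by rewrite inE => /orP[] CP xC; [left|right]; apply/bigcupP; exists C.
  + by exists C => //; rewrite inE CP.
  + by exists C => //; rewrite inE CP orbT.
- apply/trivIsetP => C D /setUP[CP|CQ] /setUP[DP|DQ] CD.
  + exact: (trivIsetP tP).
  + exact: disjointW (sP _ CP) (sQ _ DQ) dAB.
  + by rewrite disjoint_sym; exact: disjointW (sP _ DP) (sQ _ CQ) dAB.
  + exact: (trivIsetP tQ).
by rewrite inE negb_or P0 Q0.
Qed.

Lemma tileable_bigcup (J : finType) (D : {set J}) (F : J -> {set G}) :
  (forall j, j \in D -> tileable (F j)) ->
  (forall i j, i \in D -> j \in D -> i != j -> [disjoint F i & F j]) ->
  tileable (\bigcup_(j in D) F j).
Proof.
elim/set_size_ind: D => [|x D xD IH] tF dF; first by rewrite big_set0 tileable0.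
rewrite big_setU1 //=; apply: tileableU; last 1 first.
- apply: IH => [j jD|i j iD jD]; first by apply: tF; rewrite setU1r.
  by apply: dF; rewrite setU1r.
- rewrite disjoint_sym; apply: disjoint_bigcupl => j jD; rewrite disjoint_sym.
  apply: dF; rewrite ?setU11 ?setU1r //.
  by apply: contraNneq xD => ->.
- by apply: tF; rewrite setU11.
Qed.

(* The reachability of Lo and Markstrom, made robust under deleting w vertices. *)
Definition reach (w t : nat) u v : bool :=
  [forall W : {set G}, (#|W| <= w) ==>
   [exists S : {set G}, [&& #|S| <= t, [disjoint S & W], u \notin S, v \notin S,
      tileable (u |: S) & tileable (v |: S)]]].

Lemma reachP w t u v :
  reflect (forall W, #|W| <= w -> exists S : {set G},
      [/\ #|S| <= t, [disjoint S & W], u \notin S, v \notin S &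
        tileable (u |: S) /\ tileable (v |: S)])
    (reach w t u v).
Proof.
apply: (iffP forallP) => H W.
  move=> /(implyP (H W))/existsP[S /and5P[St SW uS vS /andP[tu tv]]].
  by exists S.
apply/implyP => /H[S [St SW uS vS [tu tv]]].
by apply/existsP; exists S; apply/and5P; split=> //; rewrite tu.
Qed.

Lemma reach_sym w t u v : reach w t u v = reach w t v u.
Proof.
by apply/reachP/reachP => H W /H[S [St SW uS vS [tu tv]]]; exists S.
Qed.

Lemma reach_mono w w' t t' u v :
  w' <= w -> t <= t' -> reach w t u v -> reach w' t' u v.
Proof.
move=> ww tt /reachP H; apply/reachP => W Ww.
have [|S [St SW uS vS tuv]] := H W; first exact: leq_trans ww.
by exists S; split=> //; exact: leq_trans tt.
Qed.

(** A path in the common neighbourhood is closed to a [k]-cycle by [u] as well as by [v]. *)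
Lemma reach_common_nbr (a w : nat) u v :
  2 < k -> (forall I : {set G}, independent I -> #|I| <= a) ->
  w + (k - 2) * a < #|nbr u :&: nbr v| -> reach w k.-1 u v.
Proof.
move=> k3 Ha lt; apply/reachP => W Ww.
have [|B [BZ Bk Bc]] := exists_star (Z := (nbr u :&: nbr v) :\: W) k3 Ha.
  have := leq_cardD (nbr u :&: nbr v) W; slia.
have BuE : B \subset nbr u by exact: subset_trans BZ (subset_trans (subsetDl _ _) (subsetIl _ _)).
have BvE : B \subset nbr v by exact: subset_trans BZ (subset_trans (subsetDl _ _) (subsetIr _ _)).
have k0 : 0 < k by slia.
exists B; split.
- by rewrite Bk.
- by rewrite disjoint_sym; apply: disjointWr BZ _; rewrite disjoints_subset setCD subsetUr.
- by apply/negP => /(subsetP BuE); rewrite in_nbr adj_irrefl.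
- by apply/negP => /(subsetP BvE); rewrite in_nbr adj_irrefl.
by split; apply: tileable_kcycle => //; apply: Bc.
Qed.

(** The connector is a middle vertex [x] with a link on each side: adding [u] leaves [x] to the
    second link, adding [v] leaves it to the first. Many candidates for [x] are needed, since [W]
    may contain any few of them. *)
Lemma reach_trans (w w' t : nat) u v (D : {set G}) :
  (forall x, x \in D -> reach w t u x /\ reach w t x v) ->
  w' + t < w -> w'.+2 < #|D| -> reach w' (2 * t).+1 u v.
Proof.
move=> HD wt Dw; apply/reachP => W Ww.
have [x] : exists x, x \in D :\: (u |: (v |: W)).
  apply/card_gt0P; have := leq_cardD D (u |: (v |: W)).
  by have := leq_cards1U u (v |: W); have := leq_cards1U v W; slia.
rewrite !inE !negb_or => /andP[/and3P[xu xv xW] /HD[/reachP Hu /reachP Hv]].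
have [|S1 [S1t S1W uS1 xS1 [tu1 tx1]]] := Hu (v |: W).
  by have := leq_cards1U v W; slia.
have [|S2 [S2t S2W xS2 vS2 [tx2 tv2]]] := Hv (u |: (W :|: S1)).
  have := leq_cards1U u (W :|: S1); have := leq_cardsU W S1; slia.
move: S1W S2W; rewrite ![[disjoint _ & _ |: _]]disjoint_sym !disjointU1s.
case/andP=> vS1 WS1 /andP[uS2]; rewrite disjointsUl => /andP[WS2 S12].
exists (x |: (S1 :|: S2)); split.
- have := leq_cards1U x (S1 :|: S2); have := leq_cardsU S1 S2; slia.
- by rewrite disjointU1s xW disjointsUl ![[disjoint _ & W]]disjoint_sym WS1.
- by rewrite !inE !negb_or eq_sym xu uS1 uS2.
- by rewrite !inE !negb_or eq_sym xv vS1 vS2.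
split.
- rewrite (_ : _ |: _ = (u |: S1) :|: (x |: S2)).
    by apply: tileableU; rewrite // disjointU1s !inE negb_or eq_sym xu uS2 disjoint_sym disjointU1s xS1 disjoint_sym.
  set_ac.
- rewrite (_ : _ |: _ = (x |: S1) :|: (v |: S2)).
    by apply: tileableU; rewrite // disjointU1s !inE negb_or xv xS2 disjoint_sym disjointU1s vS1 disjoint_sym.
  set_ac.
Qed.

(** Disjoint links, one for each pair, act together. A link must also avoid the vertices of the
    other pairs, hence [t + 2] for each pair. *)
Lemma connectors w t (ps : seq (G * G)) W :
  uniq (unzip1 ps ++ unzip2 ps) ->
  (forall p, p \in ps -> reach w t p.1 p.2) ->
  #|W| + size ps * t.+2 <= w ->
  exists S : {set G},
    [/\ #|S| <= size ps * t, [disjoint S & W],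
        [disjoint S & [set x in unzip1 ps ++ unzip2 ps]],
        tileable ([set x in unzip1 ps] :|: S) &
        tileable ([set x in unzip2 ps] :|: S)].
Proof.
elim: ps W => [|[u z] ps IH] W /= us Hr Ww.
  exists set0; split; rewrite ?cards0 ?disjoints0 -?setI_eq0 ?set0I //.
    by rewrite setU0 (_ : [set x in _] = set0) ?tileable0 //; apply/setP => y; rewrite !inE.
  by rewrite setU0 (_ : [set x in _] = set0) ?tileable0 //; apply/setP => y; rewrite !inE.
move: us; rewrite mem_cat inE !negb_or uniq_catC /= mem_cat negb_or uniq_catC.
case/and3P=> /and3P[u1 uz u2] /andP[z2 z1] us.
have [|p pps||S' [S't S'W S'ps tS1 tS2]] := IH (u |: (z |: W)); first by [].
- by apply: Hr; rewrite inE pps orbT.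
- have := leq_cards1U u (z |: W); have := leq_cards1U z W; slia.
have /reachP Ruz : reach w t u z by apply: (Hr (u, z)); rewrite inE eqxx.
pose L := [set x in unzip1 ps ++ unzip2 ps].
have [|S0 [S0t S0W uS0 zS0 [tu tz]]] := Ruz (W :|: (S' :|: L)).
  have := leq_cardsU W (S' :|: L); have := leq_cardsU S' L.
  have : #|L| <= size ps + size ps.
    by rewrite cardsE (leq_trans (card_size _)) // size_cat !size_map.
  slia.
move: S'W S0W; rewrite ![[disjoint S' & _ |: _]]disjoint_sym !disjointU1s !disjointsUr.
case/and3P=> uS' zS' WS' /and3P[S0W S0S' S0L].
have L1 : [set x in unzip1 ps] \subset L by apply/subsetP => x; rewrite !inE mem_cat => ->.
have L2 : [set x in unzip2 ps] \subset L by apply/subsetP => x; rewrite !inE mem_cat => ->; rewrite orbT.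
exists (S0 :|: S'); split.
- have := leq_cardsU S0 S'; slia.
- by rewrite disjointsUl S0W disjoint_sym.
- apply/disjointP => x; rewrite !inE mem_cat !inE => xS xL.
  have {}xL : [|| x == u, x == z | x \in L].
    by move: xL; rewrite !inE mem_cat => /or3P[->|->|/orP[->|->]]; rewrite ?orbT.
  case/or3P: xL => [/eqP xu|/eqP xz|xL].
  + by move: xS; rewrite xu (negbTE uS0) (negbTE uS').
  + by move: xS; rewrite xz (negbTE zS0) (negbTE zS').
  + by case/orP: xS => xS; [apply: disjointF S0L xS xL|apply: disjointF S'ps xS xL].
- rewrite (_ : _ :|: _ = (u |: S0) :|: ([set x in unzip1 ps] :|: S')).
    apply: tileableU => //; rewrite disjointU1s !inE negb_or u1 uS' disjointsUr S0S' andbT.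
    by rewrite /= andbT; exact: disjointWr L1 S0L.
  set_ac.
- rewrite (_ : _ :|: _ = (z |: S0) :|: ([set x in unzip2 ps] :|: S')).
    apply: tileableU => //; rewrite disjointU1s !inE negb_or z2 zS' disjointsUr S0S' andbT.
    by rewrite /= andbT; exact: disjointWr L2 S0L.
  set_ac.
Qed.

End Tileable.

(* Otherwise unification unfolds their quantifiers over sets of vertices. *)
#[global] Opaque kcycle tileable reach.

(** * Merging two cores *)

Section Merging.
Variables (G : sgraph) (k a : nat).
Hypothesis k3 : 2 < k.
Hypothesis Ha : forall I : {set G}, independent I -> #|I| <= a.
Implicit Types (x u v : G) (A B C D Q S W Z : {set G}).

Lemma sum_card_nbr A B : \sum_(u in A) #|nbr u :&: B| = \sum_(v in B) #|nbr v :&: A|.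
Proof.
have E X Y : \sum_(u in X) #|nbr u :&: Y| = \sum_(u in X) \sum_(v in Y) (adj u v : nat).
  apply: eq_bigr => u _; rewrite -sum1_card big_mkcond [RHS]big_mkcond /=.
  by apply: eq_bigr => v _; rewrite !inE; case: (adj u v); case: (v \in Y).
rewrite !E exchange_big /=; apply: eq_bigr => v _; apply: eq_bigr => u _.
by rewrite adj_sym.
Qed.

Lemma kcycle_one_rest C' Q W (y : nat) :
  (forall u, u \in Q -> y <= #|nbr u :&: C'|) ->
  #|W| < #|Q| -> #|W| + (k - 2) * a < y ->
  exists u B, [/\ u \in Q, B \subset C', #|B| = k.-1, kcycle k (u |: B)
    & [disjoint u |: B & W]].
Proof.
move=> Qy QW yW.
have [u] : exists u, u \in Q :\: W.
  by apply/card_gt0P; have := leq_cardD Q W; slia.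
rewrite inE => /andP[uW uQ].
have [|B [BZ Bk Bc]] := exists_star (Z := (nbr u :&: C') :\: W) k3 Ha.
  by have := leq_cardD (nbr u :&: C') W; have := Qy u uQ; slia.
exists u, B; split=> //.
- exact: subset_trans BZ (subset_trans (subsetDl _ _) (subsetIr _ _)).
- by apply: Bc; exact: subset_trans BZ (subset_trans (subsetDl _ _) (subsetIl _ _)).
by rewrite disjointU1s uW; apply: disjointWl BZ _; rewrite disjoints_subset setDE subsetIr.
Qed.

(** For [k > 3], two of any [p] vertices of [Q] outside [W] share many neighbours in [C'], and a
    path on [k - 2] of these is closed through both. For [k = 3] the second part is a single vertex,
    and the last hypothesis provides one with more than [a] neighbours in [Q] outside [W], hence
    with an edge among them. *)
Lemma kcycle_two_rest C' Q W (p y : nat) :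
  [disjoint Q & C'] ->
  (forall u, u \in Q -> y <= #|nbr u :&: C'|) ->
  p + #|W| <= #|Q| ->
  #|G| + p ^ 2 * ((k - 2) * a) < p * (y - #|W|) ->
  #|G| * a < (#|Q| - #|W|) * (y - #|W|) ->
  exists A1 A2 : {set G}, [/\ A1 \subset Q, A2 \subset C', #|A1| = 2 /\ #|A2| = k - 2,
    kcycle k (A1 :|: A2) & [disjoint A1 :|: A2 & W]].
Proof.
move=> dQC Qy pQ Hp Hna.
have WD Z : [disjoint Z :\: W & W] by rewrite disjoints_subset setDE subsetIr.
have cQ : p <= #|Q :\: W| by have := leq_cardD Q W; slia.
have Qy' u : u \in Q -> y - #|W| <= #|nbr u :&: (C' :\: W)|.
  move=> uQ; rewrite setIDA; have := leq_cardD (nbr u :&: C') W; have := Qy u uQ; slia.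
have [k3'|k4] : k = 3 \/ 3 < k by slia.
  have [v vC vQ] : exists2 v, v \in C' :\: W & a < #|nbr v :&: (Q :\: W)|.
    apply/exists_inP; apply: contraT => /exists_inPn H.
    suff : (#|Q| - #|W|) * (y - #|W|) <= #|G| * a by slia.
    apply: (@leq_trans (\sum_(u in Q :\: W) #|nbr u :&: (C' :\: W)|)).
      apply: (@leq_trans (\sum_(u in Q :\: W) (y - #|W|))).
        by rewrite sum_nat_const leq_mul // leq_subLR addnC leq_cardD.
      by apply: leq_sum => u /setDP[uQ _]; exact: Qy'.
    rewrite sum_card_nbr; apply: (@leq_trans (\sum_(v in C' :\: W) a)).
      by apply: leq_sum => v /H; rewrite -leqNgt.
    by rewrite sum_nat_const leq_mul ?max_card.
  have [|B [BZ Bk Bc]] := exists_star (Z := nbr v :&: (Q :\: W)) k3 Ha.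
    by rewrite k3' mul1n.
  have BQ : B \subset Q :\: W := subset_trans BZ (subsetIr _ _).
  exists B, [set v]; split.
  - exact: subset_trans BQ (subsetDl _ _).
  - by rewrite sub1set; case/setDP: vC.
  - by rewrite Bk cards1 k3'.
  - by rewrite setUC; apply: Bc; exact: subset_trans BZ (subsetIl _ _).
  by rewrite disjointsUl (disjointWl BQ) // disjoints1; case/setDP: vC.
have [D DQ Dp] := exists_subset_card cQ.
have /existsP[[u v] /= /and4P[uD vD uv guv]] :
    [exists i : G * G, [&& i.1 \in D, i.2 \in D, i.1 != i.2 &
      (k - 2) * a < #|(nbr i.1 :&: (C' :\: W)) :&: (nbr i.2 :&: (C' :\: W))|]].
  apply: contraT => /existsPn H.
  suff : p * (y - #|W|) <= #|G| + p ^ 2 * ((k - 2) * a) by slia.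
  have := @bonferroni _ _ D (fun u => nbr u :&: (C' :\: W)) ((k - 2) * a).
  rewrite Dp => B; apply: leq_trans (leq_trans (B _) _).
  - rewrite -Dp -sum_nat_const; apply: leq_sum => u /(subsetP DQ)/setDP[uQ _]; exact: Qy'.
  - move=> i j iD jD ij; by move: (H (i, j)); rewrite /= iD jD ij -leqNgt.
  by rewrite leq_add2r max_card.
have [|x [s [ps us ss sZ]]] :=
    @exists_path G a (k - 3) ((nbr u :&: (C' :\: W)) :&: (nbr v :&: (C' :\: W))) Ha.
  by apply: leq_ltn_trans guv; rewrite leq_mul2r; slia.
case: s ps us ss sZ => [|z s] /= ps us ss sZ; first by slia.
have inZ c : c \in x :: z :: s -> [/\ adj u c, adj v c, c \in C' & c \notin W].
  by move/sZ; rewrite !inE => /andP[/and3P[-> -> ->] /and3P[-> _ _]].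
have uQ : u \in Q :\: W by apply: (subsetP DQ).
have vQ : v \in Q :\: W by apply: (subsetP DQ).
move: (uQ) (vQ); rewrite !inE => /andP[uW uQ'] /andP[vW vQ'].
have nC c : c \in Q -> c \notin x :: z :: s.
  by move=> cQ'; apply/negP => /inZ[_ _ cC _]; exact: disjointF dQC cQ' cC.
exists [set u; v], [set c in x :: z :: s]; split.
- by apply/subsetP => c; rewrite !inE => /orP[]/eqP->.
- by apply/subsetP => c; rewrite inE => /inZ[].
- rewrite cards2 uv cardsE (card_uniqP (us : uniq (x :: z :: s))) /= ss; slia.
(* The whole path is adjacent to [u] and to [v], so [v] can be inserted after its first vertex while
   [u] joins its ends. *)
- have -> : [set u; v] :|: [set c in x :: z :: s] = [set c in u :: x :: v :: z :: s].
    apply/setP => c; rewrite !inE; by do !case: (_ == _).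
  have usz : uniq (u :: x :: v :: z :: s).
    have := nC u uQ'; have := nC v vQ'; move: us uv.
    rewrite /= !inE !negb_or => /and3P[/andP[-> ->] -> ->].
    move=> uv /and3P[vx vz ->] /and3P[-> -> ->]; rewrite uv vz eq_sym vx //.
  apply: kcycle_seq => //=; first by rewrite ss; slia.
  rewrite rcons_path.
  have [-> _ _ _] := inZ x (mem_head _ _).
  have [_ xv _ _] := inZ x (mem_head _ _).
  have [_ -> _ _] : [/\ adj u z, adj v z, z \in C' & z \notin W].
    by apply: inZ; rewrite !inE eqxx orbT.
  have [ul _ _ _] : [/\ adj u (last z s), adj v (last z s), last z s \in C' & last z s \notin W].
    by apply: inZ; rewrite in_cons mem_last orbT.
  by rewrite adj_sym xv adj_sym ul; case/andP: ps => _ ->.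
rewrite disjointsUl; apply/andP; split; apply/disjointP => c.
  by rewrite !inE => /orP[]/eqP->; apply/negP.
by rewrite inE => /inZ[_ _ _ /negP].
Qed.

(* Cycles of types (1, k - 1) and (2, k - 2) on (C, C') differ by trading one
   vertex of C for one of C', so they link v to v'. *)
Lemma reach_merge (w w' t p y q : nat) v v' C C' Q :
  v != v' -> [disjoint C & C'] -> Q \subset C ->
  (forall u, u \in C -> reach k w t u v) ->
  (forall u, u \in C' -> reach k w t u v') ->
  {in C &, forall u u', u != u' -> reach k w t u u'} ->
  {in C' &, forall u u', u != u' -> reach k w t u u'} ->
  (forall u, u \in Q -> y <= #|nbr u :&: C'|) ->
  let wW := w' + k + 2 in
  q <= #|Q| ->
  p + wW <= q -> wW + (k - 2) * a < y ->
  #|G| + p ^ 2 * ((k - 2) * a) < p * (y - wW) ->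
  #|G| * a < (q - wW) * (y - wW) ->
  w' + k.+1 * t.+2 <= w ->
  reach k w' (2 * k + k.+1 * t) v v'.
Proof.
move=> vv' dCC QC Cv Cv' CC CC' Qy wW qQ pq Hy H1 H2 Hw.
apply/reachP => W Ww.
have p0 : 0 < p by case: p {pq} H1 => //; rewrite mul0n.
pose W1 := v |: (v' |: W).
have W1w : #|W1| <= w' + 2.
  by have := leq_cards1U v (v' |: W); have := leq_cards1U v' W; rewrite -/W1; slia.
have dQC : [disjoint Q & C'] := disjointWl QC dCC.
have [|||A1 [A2 [A1Q A2C [cA1 cA2] kA dA]]] := @kcycle_two_rest C' Q W1 p y dQC Qy.
- by rewrite /wW in pq; slia.
- apply: leq_trans H1 _; rewrite leq_mul2l; rewrite /wW; slia.
- apply: leq_trans H2 _; apply: leq_mul; rewrite /wW; slia.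
have cA : #|A1 :|: A2| = k by exact: card_kcycle kA.
have W2w : #|W1 :|: (A1 :|: A2)| <= wW.
  by have := leq_cardsU W1 (A1 :|: A2); rewrite cA /wW; slia.
have [||a' [B [aQ BC cB kB dB]]] := @kcycle_one_rest C' Q (W1 :|: (A1 :|: A2)) y Qy.
- by rewrite -/wW in pq; slia.
- by slia.
have [a0 [b [ab A1E]]] : exists a0 b, a0 != b /\ A1 = [set a0; b].
  by have /cards2P[a0 [b [ab ->]]] : #|A1| == 2 by [rewrite cA1]; exists a0, b.
have [q0 q0B] : exists q0, q0 \in B by apply/card_gt0P; slia.
pose B' := B :\ q0.
have cB' : #|B'| = #|A2| by have := cardsD1 q0 B; rewrite q0B -/B'; slia.
(* The surplus [b] of the first cycle in [C] is exchanged with [v], the surplus [q0] of the second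
   cycle in [C'] with [v']. The first entries form [v'] with the first cycle, the second entries [v]
   with the second cycle. *)
pose ps := (b, v) :: (v', q0) :: (a0, a') :: zip (enum A2) (enum B').
have szE : size (enum A2) = size (enum B') by rewrite -!cardE.
have u1 : unzip1 ps = b :: v' :: a0 :: enum A2 by rewrite /= unzip1_zip ?szE.
have u2 : unzip2 ps = v :: q0 :: a' :: enum B' by rewrite /= unzip2_zip ?szE.
have sps : size ps = k.+1 by rewrite /= size_zip szE minnn -cardE cB' cA2; slia.
move: dA; rewrite disjoint_sym !disjointU1s => /and3P[vA v'A dWA].
move: dB; rewrite disjointsUr => /andP[dW1B dAB].
move: dW1B; rewrite disjoint_sym !disjointU1s => /and3P[vB v'B dWB].
have E1 : [set x in unzip1 ps] = v' |: (A1 :|: A2).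
  rewrite u1 A1E; apply/setP => x; rewrite !inE mem_enum.
  by do !case: (_ == _); rewrite ?orbT.
have E2 : [set x in unzip2 ps] = v |: (a' |: B).
  rewrite u2; apply/setP => x; rewrite !inE mem_enum !inE.
  by case: (eqVneq x q0) => [->|_]; do !case: (_ == _); rewrite ?q0B ?orbT.
have [inC inC'] : (forall x, x \in a' |: A1 -> x \in C) /\ (forall x, x \in B :|: A2 -> x \in C').
  split=> x; first by rewrite !inE => /orP[/eqP->|xA]; apply: (subsetP QC) => //; exact: (subsetP A1Q).
  by rewrite !inE => /orP[xB|xA]; [exact: (subsetP BC)|exact: (subsetP A2C)].
have us : uniq (unzip1 ps ++ unzip2 ps).
  apply/card_uniqP; rewrite size_cat !size_map sps.
  rewrite -cardsE (_ : [set x in _ ++ _] = (v' |: (A1 :|: A2)) :|: (v |: (a' |: B))); last first.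
    by rewrite -E1 -E2; apply/setP => x; rewrite [LHS]in_set mem_cat in_setU ![_ \in [set _ in _]]in_set.
  rewrite cardsU (_ : _ :&: _ = set0); last first.
    apply/eqP; rewrite setI_eq0 disjointU1s !inE.
    rewrite [v' == v]eq_sym (negbTE vv') /=.
    move: v'B; rewrite !inE => -> /=.
    by rewrite disjoint_sym disjointU1s vA dAB.
  by rewrite cards0 subn0 (cardsU1 v') v'A (cardsU1 v) vB cA (card_kcycle kB).
have [||S [St SW Sps t1 t2]] := @connectors G k w t ps W us.
- move=> [x1 x2]; rewrite !inE => /or4P[/eqP[-> ->]|/eqP[-> ->]|/eqP[-> ->]|xz].
  + by apply: Cv; apply: inC; rewrite A1E !inE eqxx !orbT.
  + by rewrite reach_sym; apply: Cv'; apply: inC'; rewrite inE q0B.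
  + apply: CC; [by apply: inC; rewrite A1E !inE eqxx orbT|by apply: inC; rewrite setU11|].
    rewrite /=; apply: contraTneq dAB => ea; rewrite disjointU1s -ea.
    by rewrite A1E !inE eqxx.
  + have x1A : x1 \in A2.
      rewrite -mem_enum -(@unzip1_zip _ _ (enum A2) (enum B')) ?szE //.
      by apply/mapP; exists (x1, x2).
    have x2B : x2 \in B'.
      rewrite -mem_enum -(@unzip2_zip _ _ (enum A2) (enum B')) ?szE //.
      by apply/mapP; exists (x1, x2).
    case/setD1P: x2B => _ x2B.
    apply: CC'; [by apply: inC'; rewrite inE x1A orbT|by apply: inC'; rewrite inE x2B|].
    rewrite /=; apply: contraTneq dAB => e; apply/negP => /disjointP/(_ x2).
    by rewrite !inE x2B -e x1A !orbT => /(_ isT isT).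
- rewrite sps; slia.
have dS : [disjoint S & v' |: (A1 :|: A2)] /\ [disjoint S & v |: (a' |: B)].
  split; apply: disjointWr Sps.
    by rewrite -E1; apply/subsetP => x; rewrite !in_set mem_cat => ->.
  by rewrite -E2; apply/subsetP => x; rewrite !in_set mem_cat => ->; rewrite orbT.
move: dS; rewrite ![[disjoint S & _]]disjoint_sym (disjointU1s v') (disjointU1s v).
case=> /andP[v'S dAS] /andP[vS dBS].
have k0 : 0 < k by slia.
(* With [v] added, the first cycle stands alone and [S] is tiled with [v] and the second one; with
   [v'] added, the cycles change roles. *)
exists ((A1 :|: A2) :|: ((a' |: B) :|: S)); split.
- have := leq_cardsU (A1 :|: A2) ((a' |: B) :|: S); have := leq_cardsU (a' |: B) S.
  rewrite cA (card_kcycle kB) sps in St *; slia.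
- by rewrite disjointsUl disjoint_sym dWA disjointsUl SW andbT disjoint_sym.
- by rewrite in_setU negb_or vA in_setU negb_or vB.
- by rewrite in_setU negb_or v'A in_setU negb_or v'B.
split.
- rewrite (_ : _ |: _ = (A1 :|: A2) :|: ((v |: (a' |: B)) :|: S)); last first.
    set_ac.
  apply: tileableU; [|exact: tileable_kcycle|by rewrite -E2].
  by rewrite disjointsUr dAS andbT disjoint_sym disjointU1s vA dAB.
- rewrite (_ : _ |: _ = (a' |: B) :|: ((v' |: (A1 :|: A2)) :|: S)); last first.
    set_ac.
  apply: tileableU; [|exact: tileable_kcycle|by rewrite -E1].
  by rewrite disjointsUr dBS andbT disjoint_sym disjointU1s v'B disjoint_sym dAB.
Qed.

End Merging.

(** * Cores *)

Section Cores.
Variables (G : sgraph) (k a delta : nat).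
Hypothesis k3 : 2 < k.
Hypothesis Ha : forall I : {set G}, independent I -> #|I| <= a.
Hypothesis Hd : forall x : G, delta <= #|nbr x|.
Implicit Types (x u v : G) (A B D Q S W Z : {set G}).

Definition unreached (w t : nat) D : bool :=
  [forall u in D, forall v in D, (u != v) ==> ~~ reach k w t u v].

Lemma unreachedP w t D :
  reflect {in D &, forall u v, u != v -> ~~ reach k w t u v} (unreached w t D).
Proof.
apply: (iffP forall_inP) => H u.
  by move=> v uD vD; apply/implyP; have /forall_inP/(_ v vD) := H u uD.
by move=> uD; apply/forall_inP => v vD; apply/implyP; exact: H.
Qed.

Lemma not_unreached_max (m w : nat) D :
  #|G| + m ^ 2 * (w + (k - 2) * a) < m * delta -> #|D| = m ->
  ~~ unreached w k.-1 D.
Proof.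
move=> lt Dm; apply: contraTN lt => /unreachedP unr; rewrite -leqNgt -Dm.
apply: leq_trans (_ : \sum_(u in D) #|nbr u| <= _).
  by rewrite -sum_nat_const; apply: leq_sum => u _; exact: Hd.
apply: leq_trans (bonferroni (g := w + (k - 2) * a) _) _; last first.
  by rewrite leq_add2r max_card.
move=> u v uD vD uv; rewrite leqNgt; apply: contra (unr u v uD vD uv).
exact: reach_common_nbr.
Qed.

(** A single vertex is unreached at every level, so a least [j] exists, and its minimality forbids
    one more vertex at the level before. The gap between the levels lets links of level [j] be
    composed to contradict unreachability at level [j + 1]. *)
Lemma extremal_unreached (m : nat) (wl tl : nat -> nat) :
  0 < m -> 0 < #|G| ->
  (forall D, #|D| = m.+1 -> ~~ unreached (wl 0) (tl 0) D) ->
  exists j D, [/\ j < m, #|D| = m - j, unreached (wl j.+1) (tl j.+1) D &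
    forall D', #|D'| = #|D|.+1 -> ~~ unreached (wl j) (tl j) D'].
Proof.
move=> m0 /card_gt0P[x _] H0.
pose Q j := [exists D : {set G}, (#|D| == m - j) && unreached (wl j.+1) (tl j.+1) D].
have Qm : exists j, Q j.
  exists m.-1; apply/existsP; exists [set x]; rewrite cards1.
  apply/andP; split; first by apply/eqP; clear -m0; lia.
  by apply/unreachedP => u v /set1P-> /set1P->; rewrite eqxx.
case: (ex_minnP Qm) => j /existsP[D /andP[/eqP Dm unr]] minj.
have jm : j < m.
  have : j <= m.-1; last by clear -m0; lia.
  apply: minj; apply/existsP; exists [set x]; rewrite cards1.
  apply/andP; split; first by apply/eqP; clear -m0; lia.
  by apply/unreachedP => u v /set1P-> /set1P->; rewrite eqxx.
exists j, D; split=> // D' D'm; apply/negP => unr'.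
case: j => [|j] in minj Dm unr unr' jm *.
  by have := H0 D'; rewrite D'm Dm subn0 unr' => /(_ erefl).
have : j.+1 <= j; last by rewrite ltnn.
apply: minj; apply/existsP; exists D'; rewrite unr' andbT D'm Dm; apply/eqP; clear -jm; lia.
Qed.

(* With U v the set of vertices that reach v, the core of v is U v minus the other
   sets U v': two unreachable vertices of it could replace v in D. *)
Lemma dense_cores (m w w' t t' e q y p : nat) D :
  #|D| <= m -> unreached w' t' D ->
  (forall D', #|D'| = #|D|.+1 -> ~~ unreached w t D') ->
  2 * k + k.+1 * t <= t' -> w' + k.+1 * t.+2 <= w ->
  let ex := m + m ^ 2 * w'.+2 + m * e in
  let wW := w' + k + 2 in
  m * y + ex <= delta -> m * q <= e -> 
  p + wW <= q -> wW + (k - 2) * a < y ->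
  #|G| + p ^ 2 * ((k - 2) * a) < p * (y - wW) ->
  #|G| * a < (q - wW) * (y - wW) ->
  exists (I : {set G}) (C : G -> {set G}),
    [/\ #|I| <= m,
        {in I &, forall i j, i != j -> [disjoint C i & C j]},
        #|~: \bigcup_(i in I) C i| <= ex,
        {in I, forall i, {in C i &, forall u v, u != v -> reach k w t u v}} &
        {in I, forall i, e <= #|C i| /\ forall W, #|W| <= w' ->
          exists B, [/\ B \subset C i, kcycle k B & [disjoint B & W]]}].
Proof.
move=> Dm unr Dmax ht hw ex wW hy hq H0 H1 H2 H3.
have {unr} /unreachedP unr := unr.
have [U inU] : exists U : G -> {set G}, forall v u, (u \in U v) = reach k w t u v.
  by exists (fun v => [set u | reach k w t u v]) => v u; exact: in_set.
pose C v := [set u | [&& reach k w t u v, u \notin D &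
    [forall v' in D, (v' != v) ==> ~~ reach k w t u v']]].
pose I := [set v in D | e <= #|C v|].
have IsD : I \subset D by apply/subsetP => v; rewrite inE => /andP[].
have Im : #|I| <= m by apply: leq_trans Dm; exact: subset_leq_card.
have CU v u : u \in C v -> [/\ reach k w t u v, u \notin D &
    forall v', v' \in D -> v' != v -> ~~ reach k w t u v'].
  rewrite in_set => /and3P[ru uD /forall_inP H]; split=> // v' v'D.
  exact/implyP/H.
have dC : {in D &, forall i j, i != j -> [disjoint C i & C j]}.
  move=> i j iD jD ij; apply/disjointP => u /CU[ri _ _] /CU[_ _ /(_ i iD ij)].
  by rewrite ri.
have hww : w' <= w by apply: leq_trans hw; exact: leq_addr.
have ktt : t <= t' by apply: leq_trans ht; rewrite mulSn; slia.
have unr' : {in D &, forall u v, u != v -> ~~ reach k w t u v}.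
  by move=> u v uD vD uv; apply: contra (unr u v uD vD uv); exact: reach_mono.
(* Otherwise [u] would enlarge [D] at the level [(w, t)]. *)
have covD u : u \notin D -> exists2 v, v \in D & reach k w t u v.
  move=> uD; apply/exists_inP; apply: contraT => /exists_inPn nr.
  have /Dmax/negP[] : #|u |: D| = #|D|.+1 by rewrite cardsU1 uD.
  apply/unreachedP => x v /setU1P[->|xD] /setU1P[->|vD]; rewrite ?eqxx // => xv.
  - exact: nr.
  - by rewrite reach_sym; exact: nr.
  - exact: unr'.
(* A larger overlap would supply the middle vertices of [reach_trans], linking [v] to [v'] at the
   level [(w', t')]. *)
have UU v v' : v \in D -> v' \in D -> v != v' -> #|U v :&: U v'| <= w'.+2.
  move=> vD v'D vv'; rewrite leqNgt; apply/negP => lt.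
  have /negP[] := unr v v' vD v'D vv'.
  apply: reach_mono (leqnn _) _ (@reach_trans G k w w' t v v' (U v :&: U v') _ _ lt).
  - by apply: leq_trans ht; clear -k3; nia.
  - by move=> x /setIP[]; rewrite !inU reach_sym.
  - by apply: leq_trans hw; clear -k3; nia.
have cliq i : i \in D -> {in C i &, forall u v, u != v -> reach k w t u v}.
  move=> iD u v /CU[ui uD uD'] /CU[vi vD vD'] uv; apply: contraT => nr.
  pose D' := u |: (v |: (D :\ i)).
  have cD' : #|D'| = #|D|.+1.
    by rewrite /D' !cardsU1 !inE negb_or uv (negbTE uD) (negbTE vD) !andbF /= (cardsD1 i D) iD.
  have /negP[] := Dmax D' cD'.
  have nrs c x : c \in C i -> x \in D :\ i -> ~~ reach k w t c x.
    by move=> /CU[_ _ H] /setD1P[xi xD]; exact: H.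
  have uC : u \in C i.
    by rewrite in_set ui uD; apply/forall_inP => v' v'D; apply/implyP; exact: uD'.
  have vC : v \in C i.
    by rewrite in_set vi vD; apply/forall_inP => v' v'D; apply/implyP; exact: vD'.
  apply/unreachedP => x z /setU1P[->|/setU1P[->|xD]] /setU1P[->|/setU1P[->|zD]] xz.
  - by case/eqP: xz.
  - exact: nr.
  - exact: nrs.
  - by rewrite reach_sym.
  - by case/eqP: xz.
  - exact: nrs.
  - by rewrite reach_sym; exact: nrs.
  - by rewrite reach_sym; exact: nrs.
  - case/setD1P: xD => _ xD; case/setD1P: zD => _ zD; exact: unr'.
have exI : #|~: \bigcup_(i in I) C i| <= ex.
  pose F (r : G * G) := if r.1 == r.2 then set0 else U r.1 :&: U r.2.
  (* An uncovered vertex lies in [D], in two of the sets [U v], or in a discarded core of fewer than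
     [e] vertices; these are the three terms of [ex]. *)
  have sub : (~: \bigcup_(i in I) C i) \subset
      (D :|: \bigcup_(r in setX D D) F r) :|: \bigcup_(i in D :\: I) C i.
    apply/subsetP => u; rewrite in_setC => uI; rewrite !in_setU.
    case: (boolP (u \in D)) => //= uD.
    have [v vD uv] := covD u uD.
    case: (boolP (u \in C v)) => uC.
      apply/orP; right; apply/bigcupP; exists v => //; rewrite in_setD vD andbT.
      by apply: contra uI => vI; apply/bigcupP; exists v.
    apply/orP; left; move: uC; rewrite in_set uv uD => /forall_inPn[v' v'D].
    rewrite negb_imply negbK => /andP[vv' uv'].
    apply/bigcupP; exists (v', v); first by rewrite in_setX v'D.
    by rewrite /F /= (negbTE vv') in_setI !inU uv uv'.
  apply: leq_trans (subset_leq_card sub) _.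
  apply: leq_trans (leq_cardsU _ _) _; apply: leq_add.
    apply: leq_trans (leq_cardsU _ _) _; apply: leq_add => //.
    apply: leq_trans (leq_card_bigcup (t := w'.+2) _) _.
      move=> [v v']; rewrite inE /F /= => /andP[vD v'D].
      by case: eqVneq => [_|vv']; rewrite ?cards0 // UU.
    by rewrite cardsX leq_mul2r mulnn leq_sqr Dm orbT.
  apply: leq_trans (leq_card_bigcup (t := e) _) _.
    by move=> v /setDP[vD]; rewrite inE vD /= -ltnNge => /ltnW.
  by rewrite leq_mul2r (leq_trans (subset_leq_card (subsetDl _ _)) Dm) orbT.
exists I, C; split=> //.
- by move=> i j /(subsetP IsD) iD /(subsetP IsD) jD; exact: dC.
- by move=> i /(subsetP IsD) iD; exact: cliq.
move=> i iI; have iD := subsetP IsD i iI; have eC : e <= #|C i| by move: iI; rewrite inE => /andP[].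
split=> //.
pose Q j := [set u in C i | y <= #|nbr u :&: C j|].
(* A vertex with fewer than [y] neighbours in every core would have degree at most
   [m * (y - 1) + ex], below [delta]. *)
have CQ : C i \subset \bigcup_(j in I) Q j.
  apply/subsetP => u uC; apply: contraT => nu.
  suff : #|nbr u| <= #|\bigcup_(j in I) (nbr u :&: C j)| + ex.
    have : #|\bigcup_(j in I) (nbr u :&: C j)| <= #|I| * y.-1.
      apply: leq_card_bigcup => j jI; rewrite -ltnS prednK; last by slia.
      rewrite ltnNge; apply: contra nu => yu; apply/bigcupP; exists j => //.
      by rewrite inE uC.
    have := Hd u; have : 0 < #|I| by apply/card_gt0P; exists i.
    have : 0 < y by slia.
    move: Im hy; clear; set cI := #|I|; case: y => // y' /=; nia.
  rewrite -big_distrr /=; apply: leq_trans (leq_add (leqnn _) exI).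
  rewrite -(cardsID (\bigcup_(i in I) C i) (nbr u)) leq_add2l.
  by rewrite subset_leq_card // setDE subsetIr.
have [j jI qQ] : exists2 j, j \in I & q <= #|Q j|.
  apply/exists_inP; apply: contraT => /exists_inPn H.
  have q0 : 0 < q by slia.
  have : #|\bigcup_(j in I) Q j| <= #|I| * q.-1.
    by apply: leq_card_bigcup => j /H; rewrite -ltnNge => h; clear -q0 h; lia.
  have := subset_leq_card CQ; have : 0 < #|I| by apply/card_gt0P; exists i.
  move: Im hq eC q0; clear; case: q => // q' /=; nia.
have QC : Q j \subset C i by apply/subsetP => u; rewrite inE => /andP[].
have Qy u : u \in Q j -> y <= #|nbr u :&: C j| by rewrite inE => /andP[].
have jD := subsetP IsD j jI.
(* Either the rich vertices point into their own core and give the cycle wanted, or merging the two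
   cores contradicts the unreachability of [i] and [j]. *)
case: (eqVneq i j) => [ij|ij] W Ww.
  have [||u [B [uQ BC Bk kB dB]]] := @kcycle_one_rest G k a k3 Ha (C j) (Q j) W y Qy.
  - by rewrite /wW in H0; slia.
  - by rewrite /wW in H1; slia.
  exists (u |: B); split=> //.
  by rewrite ij subUset BC sub1set -ij (subsetP QC).
have /negP[] := unr i j iD jD ij.
apply: reach_mono (leqnn _) ht _.
apply: (@reach_merge G k a k3 Ha w w' t p y q i j (C i) (C j) (Q j)) => //.
- exact: dC.
- by move=> u /CU[].
- by move=> u /CU[].
- exact: cliq.
- exact: cliq.
Qed.

End Cores.

(** * Hall's theorem and expanders *)

Section Hall.
Variables (A B : finType) (b0 : B).

(** Induction on [#|D|]: a tight proper subset splits the problem in two; without one, any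
    admissible value can be given to [x0] and removed everywhere else. *)
Lemma hall (D : {set A}) (r : A -> {set B}) :
  (forall F : {set A}, F \subset D -> #|F| <= #|\bigcup_(x in F) r x|) ->
  exists f : A -> B, {in D &, injective f} /\ {in D, forall x, f x \in r x}.
Proof.
have [n] := ubnP #|D|; elim: n D r => // n IH D r; rewrite ltnS => Dn HD.
have [->|[x0 x0D]] := set_0Vmem D.
  by exists (fun=> b0); split=> x; rewrite inE.
case: (boolP [exists F : {set A}, [&& F \proper D, F != set0 & #|\bigcup_(x in F) r x| == #|F|]]).
  case/existsP=> F /and3P[FD F0 /eqP tight].
  have FsD := proper_sub FD.
  have [||f1 [inj1 f1r]] := IH F r.
  - exact: leq_trans (proper_card FD) Dn.
  - by move=> F' F'F; apply: HD; exact: subset_trans FsD.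
  pose r' x := r x :\: \bigcup_(x in F) r x.
  have [||f2 [inj2 f2r]] := IH (D :\: F) r'.
  - apply: leq_trans Dn; rewrite -(cardsID F D) (setIidPr FsD).
    by rewrite -[X in X < _]add0n ltn_add2r card_gt0.
  - move=> F' /subsetDP[F'D dF].
    have /HD : F :|: F' \subset D by rewrite subUset FsD.
    rewrite cardsU (_ : F :&: F' = set0) ?cards0 ?subn0; last first.
      by apply/eqP; rewrite setI_eq0 disjoint_sym.
    rewrite bigcup_setU (_ : _ :|: _ = (\bigcup_(x in F) r x) :|: (\bigcup_(x in F') r' x)).
      have := leq_cardsU (\bigcup_(x in F) r x) (\bigcup_(x in F') r' x); rewrite tight; slia.
    apply/setP => y; rewrite !inE; case: (boolP (y \in _)) => //= yF.
    apply/bigcupP/bigcupP => -[x xF' yr]; exists x => //; first by rewrite inE yF.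
    by case/setDP: yr.
  exists (fun x => if x \in F then f1 x else f2 x); split=> [x y|x] xD.
    move=> yD; case: ifP => xF; case: ifP => yF.
    + exact: inj1.
    + move=> e; have := f2r y; rewrite !inE yF yD -e => /(_ isT)/andP[/bigcupP[]].
      by exists x => //; exact: f1r.
    + move=> e; have := f2r x; rewrite !inE xF xD e => /(_ isT)/andP[/bigcupP[]].
      by exists y => //; exact: f1r.
    + by apply: inj2; rewrite inE ?xF ?yF.
  case: ifP => xF; first exact: f1r.
  by have := f2r x; rewrite inE xF xD inE => /(_ isT)/andP[].
move=> /existsPn ntight.
have [y yx0] : exists y, y \in r x0.
  apply/card_gt0P; have := HD [set x0]; rewrite sub1set x0D cards1 big_set1.
  exact.
have [||f [inj fr]] := IH (D :\ x0) (fun x => r x :\ y).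
- by rewrite (cardsD1 x0) x0D in Dn; slia.
- move=> F FD; have [->|F0] := eqVneq F set0; first by rewrite cards0.
  have FsD : F \subset D := subset_trans FD (subD1set _ _).
  have Fp : F \proper D.
    apply/properP; split=> //; exists x0 => //.
    by apply/negP => /(subsetP FD); rewrite !inE eqxx.
  have := ntight F; rewrite Fp F0 /= => ne.
  have {}ne : #|F| < #|\bigcup_(x in F) r x| by rewrite ltn_neqAle eq_sym ne HD.
  rewrite -ltnS; apply: leq_trans ne _.
  apply: leq_trans (leq_cards1U y _); apply: subset_leq_card.
  apply/subsetP => z /bigcupP[x xF zr]; rewrite !inE; case: eqP => //= zy.
  by apply/bigcupP; exists x => //; rewrite !inE zr andbT; apply/eqP.
exists (fun x => if x == x0 then y else f x); split=> [x x'|x] xD.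
  move=> x'D; case: eqP => xx; case: eqP => xx'; first by rewrite xx.
  - have /setD1P[/eqP ny _] : f x' \in r x' :\ y.
      by apply: fr; rewrite !inE x'D andbT; apply/eqP.
    by move/esym.
  - have /setD1P[/eqP ny _] : f x \in r x :\ y.
      by apply: fr; rewrite !inE xD andbT; apply/eqP.
    by move=> e; case: ny.
  - by apply: inj; rewrite !inE ?xD ?x'D andbT; apply/eqP.
case: eqP => [->//|/eqP xx].
by have := fr x; rewrite !inE xx xD => /(_ isT)/andP[].
Qed.
End Hall.

(** * Bipartite expanders by the first moment method *)

Section Expander.

Lemma leq_exp m n e : m <= n -> m ^ e <= n ^ e.
Proof. by case: e => // e; rewrite leq_exp2r. Qed.

Lemma ffact_leq_exp n m : n ^_ m <= n ^ m.
Proof.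
elim: m n => // m IH n; rewrite ffactnS expnS leq_mul2l; apply/orP; right.
by apply: leq_trans (IH _) _; apply: leq_exp; exact: leq_pred.
Qed.

Lemma exp_leq_ffact n m : (n - m) ^ m <= n ^_ m.
Proof.
elim: m n => // m IH [|n]; first by rewrite sub0n exp0n.
rewrite ffactSS expnS subSS; apply: leq_mul => //.
by apply: leq_trans (leq_subr m n) _.
Qed.

Lemma bin_leq_exp2 n m : 'C(n, m) <= 2 ^ n.
Proof.
rewrite -[n in 'C(n, _)]card_ord -card_draws; apply: leq_trans (max_card _) _.
by rewrite -cardsT -powersetT card_powerset cardsT card_ord.
Qed.

(** A substitute for Stirling's formula: [m ^ m] is at most the falling factorial of [2 * m] of
    length [m], which is a binomial of size at most [4 ^ m] times the factorial of [m]. *)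
Lemma bin_exp_leq n m : 'C(n, m) * m ^ m <= (4 * n) ^ m.
Proof.
have fm : m ^ m <= 4 ^ m * m`!.
  have := exp_leq_ffact (m + m) m; rewrite addnK -bin_ffact => H.
  apply: leq_trans H _; rewrite leq_mul2r; apply/orP; right.
  by apply: leq_trans (bin_leq_exp2 _ _) _; rewrite addnn -mul2n expnM.
apply: leq_trans (leq_mul (leqnn _) fm) _.
by rewrite mulnCA bin_ffact expnMn leq_mul2l ffact_leq_exp orbT.
Qed.

(** Origin of the 17: two of the powers [y ^ y] pay for the binomials, which become [(8 * b) ^ y]
    and [(4 * b) ^ y], and the other 15 gain [(3/4)^15 <= 1/64] per factor, which covers
    [8 * 4 * 2]. *)
Lemma expander_term a b y : 4 * y <= 3 * b -> a <= 2 * b ->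
  'C(a, y) * ('C(b, y) * (y ^ (17 * y))) * 2 ^ y <= b ^ (17 * y).
Proof.
move=> yb ab.
have yb5 : 4 * y ^ 5 <= b ^ 5.
  have H : (4 * y) ^ 5 <= (3 * b) ^ 5 by rewrite leq_exp2r.
  rewrite -(@leq_pmul2l (4 ^ 4)) // mulnA -expnSr -expnMn.
  by apply: leq_trans H _; rewrite expnMn leq_mul2r orbT.
have yb15 : 64 * y ^ 15 <= b ^ 15.
  by rewrite (expnM y 5 3) (expnM b 5 3) (_ : 64 = 4 ^ 3) // -expnMn leq_exp.
have -> : 17 * y = y + y + 15 * y by lia.
rewrite !(expnD _ (y + y) (15 * y)) !(expnD _ y y).
have -> : 'C(a, y) * ('C(b, y) * (y ^ y * y ^ y * y ^ (15 * y))) * 2 ^ y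
   = ('C(a, y) * y ^ y) * ('C(b, y) * y ^ y) * (y ^ (15 * y) * 2 ^ y).
  by move: (y ^ y) (y ^ (15 * y)) (2 ^ y) ('C(a, y)) ('C(b, y)) => *; ring.
apply: leq_trans (leq_mul (leq_mul (bin_exp_leq a y) (bin_exp_leq b y)) (leqnn _)) _.
apply: leq_trans (_ : (4 * (2 * b)) ^ y * (4 * b) ^ y * (y ^ (15 * y) * 2 ^ y) <= _).
  by rewrite !leq_mul // leq_exp // leq_mul2l ab orbT.
rewrite !(expnM _ 15) -!expnMn; apply: leq_exp.
by move: yb15; set z := y ^ 15; set c := b ^ 15; nia.
Qed.
End Expander.

Lemma leq_card_bigcup_sum (J T : finType) (P : pred J) (F : J -> {set T}) :
  #|\bigcup_(j | P j) F j| <= \sum_(j | P j) #|F j|.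
Proof.
elim/big_rec2: _ => [|j s S _ IH]; first by rewrite cards0.
by apply: leq_trans (leq_cardsU _ _) _; rewrite leq_add2l.
Qed.

Lemma exists_superset_card (T : finType) (A : {set T}) s :
  #|A| <= s -> s <= #|T| -> exists2 B : {set T}, A \subset B & #|B| = s.
Proof.
move=> As sT; have [|B BA Bs] := @exists_subset_card _ (~: A) (s - #|A|).
  by have := cardsC A; lia.
exists (A :|: B); first exact: subsetUl.
rewrite cardsU (_ : A :&: B = set0) ?cards0 ?Bs; first by lia.
by apply/eqP; rewrite setI_eq0 disjoint_sym disjoints_subset.
Qed.

Lemma card_family_on (A B I : finType) (Y : {set A}) (N : {set B}) :
  #|[set f : {ffun A * I -> B} | [forall p, (p.1 \in Y) ==> (f p \in N)]]|
  = #|N| ^ (#|I| * #|Y|) * #|B| ^ (#|I| * (#|A| - #|Y|)).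
Proof.
pose F (p : A * I) := if p.1 \in Y then mem N else mem [set: B].
have -> : #|[set f : {ffun A * I -> B} | [forall p, (p.1 \in Y) ==> (f p \in N)]]|
   = #|family F|.
  rewrite -cardsE; apply: eq_card => f; rewrite !inE; apply/forallP/familyP => H p.
    by have := H p; rewrite /F; case: ifP => //= _ _; rewrite inE.
  by have := H p; rewrite /F; case: ifP.
rewrite card_family foldrE big_map big_enum /= (bigID (fun p => p.1 \in Y)) /=.
congr (_ * _).
  rewrite (eq_bigr (fun=> #|N|)); last by move=> p pY; rewrite /F pY.
  rewrite prod_nat_const; congr (_ ^ _).
  by rewrite mulnC -cardsT -cardsX; apply: eq_card => p; rewrite !inE andbT.
rewrite (eq_bigr (fun=> #|B|)); last by move=> p pY; rewrite /F (negbTE pY) cardsT.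
rewrite prod_nat_const; congr (_ ^ _).
have -> : #|A| - #|Y| = #|~: Y| by rewrite -(cardsC Y) addKn.
by rewrite mulnC -cardsT -cardsX; apply: eq_card => p; rewrite !inE andbT.
Qed.

Lemma sum_geometric n : \sum_(i < n) 2 ^ (n - i.+1) = 2 ^ n - 1.
Proof.
elim: n => [|n IH]; first by rewrite big_ord0.
rewrite big_ord_recl /= (eq_bigr (fun i : 'I_n => 2 ^ (n - i.+1))) // IH.
by rewrite subn1 expnS; have : 0 < 2 ^ n; [rewrite expn_gt0|move: (2 ^ n) => c; lia].
Qed.

(* First moment: 17 random choices for each element of A work. *)
Lemma expander (A B : finType) : 0 < #|B| -> #|A| <= 2 * #|B| ->
  exists g : A -> {set B}, (forall x, #|g x| <= 17) /\
    forall Y : {set A}, 4 * #|Y| <= 3 * #|B| -> #|Y| <= #|\bigcup_(x in Y) g x|.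
Proof.
set a := #|A|; set b := #|B| => b0 ab.
pose g (f : {ffun A * 'I_17 -> B}) x := [set f (x, i) | i : 'I_17].
case: (boolP [exists f, [forall Y : {set A}, (4 * #|Y| <= 3 * b) ==>
    (#|Y| <= #|\bigcup_(x in Y) g f x|)]]).
  case/existsP=> f /forallP H; exists (g f); split.
    by move=> x; apply: leq_trans (leq_imset_card _ _) _; rewrite card_ord.
  by move=> Y; move/implyP: (H Y).
move=> /existsPn bad; exfalso.
pose Fam (Y : {set A}) (N : {set B}) :=
  [set f : {ffun A * 'I_17 -> B} | [forall p, (p.1 \in Y) ==> (f p \in N)]].
(* A bad function sends some [Y] into a set [N] of the same size. The index [y] stands for
   [#|Y| - 1], since a bad [Y] is not empty. *)
have cov : [set: {ffun A * 'I_17 -> B}] \subset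
    \bigcup_(y < b | 4 * y.+1 <= 3 * b)
      \bigcup_(Y in [set Y : {set A} | #|Y| == y.+1])
        \bigcup_(N in [set N : {set B} | #|N| == y.+1]) Fam Y N.
  apply/subsetP => f _; have /forallPn[Y] := bad f.
  rewrite negb_imply -ltnNge => /andP[Yb lt].
  have Yb' : #|Y| <= b by move: Yb; clear; lia.
  have [N sN cN] := exists_superset_card (ltnW lt) Yb'.
  have Y0 : 0 < #|Y| by apply: leq_ltn_trans lt.
  have yb : #|Y|.-1 < b by rewrite prednK.
  apply/bigcupP; exists (Ordinal yb) => /=; first by rewrite prednK.
  apply/bigcupP; exists Y; first by rewrite inE prednK.
  apply/bigcupP; exists N; first by rewrite inE prednK // cN.
  rewrite inE; apply/forallP => -[x i]; apply/implyP => /= xY.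
  apply: (subsetP sN); apply/bigcupP; exists x => //.
  by apply/imsetP; exists i.
have := subset_leq_card cov; rewrite leqNgt => /negP; apply.
apply: leq_ltn_trans (leq_card_bigcup_sum _ _) _.
rewrite cardsT card_ffun card_prod card_ord -/a -/b.
(* The term [y] is at most a share [1 / 2^(y + 1)] of all functions; the factor [2 ^ b] keeps this
   geometric series within the naturals. *)
rewrite -(ltn_pmul2r (expn_gt0 2 b : _ = true)) big_distrl /=.
apply: (@leq_ltn_trans (\sum_(y < b) b ^ (a * 17) * 2 ^ (b - y.+1))); last first.
  rewrite -big_distrr sum_geometric ltn_pmul2l ?expn_gt0 ?b0 //.
  by rewrite subn1 prednK ?expn_gt0.
rewrite big_mkcond; apply: leq_sum => y _; case: ifP => // yb.
have [ya|ay] := leqP y.+1 a; last first.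
  rewrite (_ : [set Y : {set A} | #|Y| == y.+1] = set0) ?big_set0 ?cards0 //.
  apply/setP => Y; rewrite !inE; apply/negbTE; apply: contraTneq ay => <-.
  by rewrite -leqNgt max_card.
set t := #|_|.
have tb : t <= 'C(a, y.+1) * ('C(b, y.+1) * (y.+1 ^ (17 * y.+1) * b ^ (17 * (a - y.+1)))).
  rewrite /t -!card_draws; apply: leq_card_bigcup => Y; rewrite inE => /eqP Yy.
  apply: leq_card_bigcup => N; rewrite inE => /eqP Ny.
  by rewrite card_family_on card_ord Yy Ny.
rewrite (_ : 2 ^ b = 2 ^ y.+1 * 2 ^ (b - y.+1)); last by rewrite -expnD subnKC.
rewrite mulnA leq_mul2r; apply/orP; right.
apply: leq_trans (leq_mul tb (leqnn _)) _.
rewrite (_ : b ^ (a * 17) = b ^ (17 * y.+1) * b ^ (17 * (a - y.+1))); last first.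
  by rewrite -expnD -mulnDr subnKC // mulnC.
have := expander_term yb ab.
move: (y.+1 ^ _) (b ^ _) ('C(a, _)) ('C(b, _)) (2 ^ y.+1) (b ^ (_ * (_ - _))) => c1 c2 c3 c4 c5 c6 H.
by rewrite (_ : _ * _ * c5 = (c3 * (c4 * c1) * c5) * c6) ?leq_mul //; ring.
Qed.

Lemma expander_sets (A B : finType) (SA : {set A}) (SB : {set B}) :
  0 < #|SB| -> #|SA| <= 2 * #|SB| ->
  exists g : A -> {set B}, [/\ forall x, g x \subset SB, forall x, #|g x| <= 17 &
    forall Y : {set A}, Y \subset SA -> 4 * #|Y| <= 3 * #|SB| ->
      #|Y| <= #|\bigcup_(x in Y) g x|].
Proof.
move=> SB0 SAB.
have [||g [g17 gY]] := @expander {x | x \in SA} {x | x \in SB}; rewrite ?card_sig //.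
pose g' (x : A) := if insub x is Some x' then [set val y | y in g x'] else set0.
exists g'; split=> [x|x|Y YA Yb].
- rewrite /g'; case: insubP => [x' _ _|_]; last exact: sub0set.
  by apply/subsetP => y /imsetP[y' _ ->]; exact: valP y'.
- rewrite /g'; case: insubP => [x' _ _|_]; last by rewrite cards0.
  by apply: leq_trans (leq_imset_card _ _) _; exact: g17.
pose Y' := [set x : {x | x \in SA} | val x \in Y].
have YE : Y = [set val x | x in Y'].
  apply/setP => x; apply/idP/imsetP => [xY|[x' + ->]]; last by rewrite inE.
  by exists (Sub x (subsetP YA x xY)); rewrite ?inE SubK.
have cY : #|Y| = #|Y'| by rewrite {1}YE card_imset //; exact: val_inj.
rewrite cY; apply: leq_trans (gY Y' _) _.
  by rewrite -cY card_sig; apply: leq_trans Yb _; rewrite leq_mul2l (eq_leq _) // -cardsE; apply: eq_card => y; rewrite !inE.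
rewrite -(card_imset _ (@val_inj _ _ {x | x \in SB})); apply: subset_leq_card.
apply/subsetP => z /imsetP[y /bigcupP[x xY yg] ->].
apply/bigcupP; exists (val x); first by move: xY; rewrite inE.
by rewrite /g' valK; apply: imset_f.
Qed.

(* A robustly matchable bipartite graph, as in Montgomery's absorption method. *)
Lemma template (E V : finType) (X1 X2 : {set V}) (h : nat) (v0 : V) :
  0 < h -> #|E| = 4 * h -> #|X2| = 3 * h -> #|X1| = 2 * h -> [disjoint X1 & X2] ->
  exists r : E -> {set V},
    [/\ forall e, r e \subset X1 :|: X2,
        #|[set p : E * V | p.2 \in r p.1]| <= 153 * h &
        forall R : {set V}, R \subset X1 -> #|R| = h ->
          exists f : E -> V, [/\ injective f, forall e, f e \in r e &
            [set f e | e : E] = X2 :|: R]].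
Proof.
move=> h0 cE cX2 cX1 dX.
have cX : #|X1 :|: X2| = 5 * h.
  by rewrite cardsU (_ : _ :&: _ = set0) ?cards0 ?cX1 ?cX2; [lia|apply/eqP; rewrite setI_eq0].
have [||gA [gAs gA17 gAY]] := @expander_sets E V [set: E] X2.
- by rewrite cX2; lia.
- by rewrite cardsT cE cX2; lia.
have [||gB [gBs gB17 gBY]] := @expander_sets V E (X1 :|: X2) [set: E].
- by rewrite cardsT cE; lia.
- by rewrite cardsT cE cX; lia.
pose r e := gA e :|: [set x in X1 :|: X2 | e \in gB x].
exists r; split.
- move=> e; rewrite subUset; apply/andP; split.
    exact: subset_trans (gAs e) (subsetUr _ _).
  by apply/subsetP => x; rewrite inE => /andP[].
- pose FA e := [set (e, x) | x in gA e].
  pose FB x := [set (e, x) | e in gB x].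
  have sub : [set p : E * V | p.2 \in r p.1] \subset
     (\bigcup_(e in [set: E]) FA e) :|: \bigcup_(x in X1 :|: X2) FB x.
    apply/subsetP => -[e x]; rewrite inE /= => /setUP[xe|].
      by apply/setUP; left; apply/bigcupP; exists e => //; apply: imset_f.
    rewrite inE => /andP[xX ex]; apply/setUP; right; apply/bigcupP; exists x => //.
    exact: (imset_f (fun e => (e, x))).
  apply: leq_trans (subset_leq_card sub) _; apply: leq_trans (leq_cardsU _ _) _.
  (* There are 17 edges for each of [4 * h] and [5 * h] vertices, hence 153. *)
  have := @leq_card_bigcup _ _ [set: E] FA 17; have := @leq_card_bigcup _ _ (X1 :|: X2) FB 17.
  rewrite cX cardsT cE => H1 H2.
  have {}H1 := H1 (fun x _ => leq_trans (leq_imset_card _ _) (gB17 x)).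
  have {}H2 := H2 (fun x _ => leq_trans (leq_imset_card _ _) (gA17 x)).
  by lia.
move=> R RX Rh.
have cXR : #|X2 :|: R| = 4 * h.
  rewrite cardsU (_ : _ :&: _ = set0) ?cards0 ?cX2 ?Rh; first by lia.
  by apply/eqP; rewrite setI_eq0 disjoint_sym; exact: disjointWl RX dX.
have XRs : X2 :|: R \subset X1 :|: X2.
  by rewrite subUset subsetUr (subset_trans RX) ?subsetUl.
have [|f [inj fr]] := @hall E V v0 [set: E] (fun e => r e :&: (X2 :|: R)).
  (* Up to [2 * h] elements expand inside [X2], which does not depend on [R]. If a larger [F]
     violates Hall's condition, then [4 * h - #|F| + 1] vertices of [X2 :|: R] have all their
     [gB]-neighbours outside [F], too few for the expansion of [gB]. *)
  move=> F _; have [Fh|Fh] := leqP #|F| (2 * h).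
    apply: leq_trans (gAY F (subsetT _) _) _; first by rewrite cX2; lia.
    apply: subset_leq_card; apply/subsetP => x /bigcupP[e eF xe].
    apply/bigcupP; exists e => //; rewrite !inE xe /=.
    by rewrite (subsetP (gAs e)).
  rewrite leqNgt; apply/negP => lt.
  set N := \bigcup_(x in F) _ in lt.
  have FE : #|F| <= 4 * h by rewrite -cE max_card.
  have [|Y YN cY] := @exists_subset_card _ ((X2 :|: R) :\: N) (4 * h - #|F|).+1.
    by have := leq_cardD (X2 :|: R) N; lia.
  have := gBY Y (subset_trans (subset_trans YN (subsetDl _ _)) XRs).
  rewrite cardsT cE cY => /(_ ltac:(lia)) /(fun H => leq_trans H (subset_leq_card (_ : _ \subset ~: F))) H.
  have : (4 * h - #|F|).+1 <= #|~: F|.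
    apply: H; apply/subsetP => e /bigcupP[x xY ex]; rewrite inE; apply/negP => eF.
    have /setDP[xX xN] := subsetP YN x xY.
    move/negP: xN; apply; apply/bigcupP; exists e => //.
    by rewrite inE xX andbT !inE ex -in_setU (subsetP XRs) ?orbT.
  by have := cardsC F; rewrite cE; lia.
have fr' e : f e \in r e /\ f e \in X2 :|: R by apply/setIP; apply: fr; rewrite inE.
have injf : injective f by move=> x y; apply: inj; rewrite inE.
exists f; split=> // [e|]; first by case: (fr' e).
apply/eqP; rewrite eqEcard; apply/andP; split.
  by apply/subsetP => x /imsetP[e _ ->]; case: (fr' e).
by rewrite cXR card_imset // cE.
Qed.

(** * Absorption *)

Section Absorbing.
Variables (G : sgraph) (k : nat).
Hypothesis k0 : 0 < k.
Implicit Types (x u v : G) (A B C D K Q R S W X Z : {set G}).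

(** The absorber is a cycle [B] in the core with a connector between [K] and [B]. Alone, the
    connector is tiled with [B]; in the presence of [K] it is tiled with [K], and [B] stands
    alone. *)
Lemma exists_absorber (w w' t : nat) C K W :
  {in C &, forall u v, u != v -> reach k w t u v} ->
  (forall W, #|W| <= w' -> exists B, [/\ B \subset C, kcycle k B & [disjoint B & W]]) ->
  K \subset C -> #|K| = k -> #|W| + k <= w' -> #|W| + k * t.+2 <= w ->
  exists A, [/\ #|A| <= k * t.+1, [disjoint A & W], [disjoint A & K],
    tileable k A & tileable k (A :|: K)].
Proof.
move=> cliq dense KC Kk Ww' Ww.
have [|B [BC kB]] := dense (W :|: K).
  by have := leq_cardsU W K; rewrite Kk; slia.
rewrite disjointsUr => /andP[dBW dBK].
have Bk := card_kcycle kB.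
pose ps := zip (enum K) (enum B).
have szE : size (enum K) = size (enum B) by rewrite -!cardE Kk Bk.
have u1 : unzip1 ps = enum K by rewrite unzip1_zip ?szE.
have u2 : unzip2 ps = enum B by rewrite unzip2_zip ?szE.
have sps : size ps = k by rewrite size_zip szE minnn -cardE.
have [|x||S [St SW Sps t1 t2]] := @connectors G k w t ps W.
- rewrite u1 u2 cat_uniq !enum_uniq andbT /=.
  apply/hasPn => x; rewrite !mem_enum => xB; apply/negP => xK.
  exact: disjointF dBK xB xK.
- case: x => u v uv.
  have uK : u \in K by rewrite -mem_enum -u1; apply/mapP; exists (u, v).
  have vB : v \in B by rewrite -mem_enum -u2; apply/mapP; exists (u, v).
  apply: cliq; [exact: (subsetP KC)|exact: (subsetP BC)|rewrite /=].
  by apply/eqP => e; apply: disjointF dBK vB _; rewrite -e.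
- by rewrite sps.
move: t1 t2 Sps; rewrite u1 u2 !set_enum => t1 t2 dS.
have [dSK dSB] : [disjoint S & K] /\ [disjoint S & B].
  split; apply: disjointWr dS; apply/subsetP => x xX; rewrite inE mem_cat !mem_enum xX ?orbT //.
exists (B :|: S); split=> //.
- by have := leq_cardsU B S; rewrite sps in St; rewrite Bk mulnS; slia.
- by rewrite disjointsUl dBW.
- by rewrite disjointsUl dBK.
rewrite -setUA [S :|: K]setUC; apply: tileableU => //; last exact: tileable_kcycle.
by rewrite disjointsUr dBK disjoint_sym.
Qed.

(* Each template vertex e becomes a set Z e of k - 1 vertices, and each template
   edge (e, x) an absorber for x |: Z e, which is used if e is matched to x. *)
Lemma exists_gadget (T cap h : nat) C X W :
  (forall K W, K \subset C -> #|K| = k -> #|W| <= cap ->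
     exists A, [/\ #|A| <= T, [disjoint A & W], [disjoint A & K],
       tileable k A & tileable k (A :|: K)]) ->
  cap + k <= #|C| -> 0 < h -> X \subset C -> #|X| = 2 * h ->
  #|W| + 5 * h + 4 * h * k + 153 * h * T <= cap ->
  exists Q, [/\ [disjoint Q & W], [disjoint Q & X],
    #|Q| <= 3 * h + 4 * h * k + 153 * h * T &
    forall R, R \subset X -> #|R| = h -> tileable k (Q :|: R)].
Proof.
move=> Habs capC h0 XC cX capW.
have [v0 _] : exists v0, v0 \in C by apply/card_gt0P; lia.
have [|X2 X2C cX2] := @exists_subset_card _ (C :\: (W :|: X)) (3 * h).
  by have := leq_cardD C (W :|: X); have := leq_cardsU W X; lia.
have dX : [disjoint X & X2].
  rewrite disjoint_sym; apply: disjointWl X2C _.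
  by rewrite disjoints_subset setDE setCU subIset // subsetIr orbT.
have dX2W : [disjoint X2 & W].
  apply: disjointWl X2C _.
  by rewrite disjoints_subset setDE setCU subIset // subsetIl orbT.
have cE : #|{: 'I_(4 * h)}| = 4 * h by rewrite card_ord.
have [r [rX cr Hr]] := template v0 h0 cE cX2 cX dX.
pose W1 := W :|: (X :|: X2).
have cW1 : #|W1| <= #|W| + 5 * h.
  by have := leq_cardsU W (X :|: X2); have := leq_cardsU X X2; rewrite -/W1; lia.
have [|| Z [Zk _ ZW1 ZZ]] := @greedy_family _ _ [set: 'I_(4 * h)]
    (fun _ S => S \subset C /\ #|S| = k.-1) k.-1 cap W1.
- move=> e W' _ W'cap; have [|S SC cS] := @exists_subset_card _ (C :\: W') k.-1.
    by have := leq_cardD C W'; lia.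
  exists S; split; rewrite ?cS //.
    by split=> //; exact: subset_trans SC (subsetDl _ _).
  by apply: disjointWl SC _; rewrite disjoints_subset setDE subsetIr.
- rewrite cardsT cE; nia.
pose Zs := \bigcup_(e in [set: 'I_(4 * h)]) Z e.
have cZs : #|Zs| <= 4 * h * k.-1.
  rewrite -[in leqRHS]cE -cardsT; apply: leq_card_bigcup => e eE.
  by case: (Zk e eE) => _ ->.
have W1X x : x \in X :|: X2 -> x \in W1 by move=> xX; rewrite inE xX orbT.
have XXC x : x \in X :|: X2 -> x \in C.
  by case/setUP => [/(subsetP XC)//|/(subsetP X2C)/setDP[]].
pose Ed := [set p : 'I_(4 * h) * G | p.2 \in r p.1].
pose K (p : 'I_(4 * h) * G) := p.2 |: Z p.1.
have EdX p : p \in Ed -> p.2 \in X :|: X2 by rewrite inE => /(subsetP (rX _)).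
have Zx e x : x \in X :|: X2 -> x \notin Z e.
  move=> xX; apply/negP => xZ.
  exact: disjointF (ZW1 e (in_setT _)) xZ (W1X _ xX).
have [|| S [SP St SW SS]] := @greedy_family _ _ Ed
    (fun p A => [/\ [disjoint A & K p], tileable k A & tileable k (A :|: K p)])
    T cap (W1 :|: Zs).
- move=> p W' pE W'cap.
  have [||A [At AW AK tA tAK]] := Habs (K p) W' _ _ W'cap.
  + by rewrite subUset sub1set XXC ?EdX //; case: (Zk p.1 (in_setT _)).
  + by rewrite cardsU1 Zx ?EdX //; case: (Zk p.1 (in_setT _)) => _ ->; lia.
  by exists A.
- have := leq_cardsU W1 Zs; move: cr cZs cW1 capW; rewrite -/Ed; clear -k0 h0; nia.
pose Ss := \bigcup_(p in Ed) S p.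
have cSs : #|Ss| <= 153 * h * T.
  apply: leq_trans (leq_card_bigcup St) _; by rewrite leq_mul2r cr orbT.
have dSs : [disjoint Ss & W1 :|: Zs] by apply: disjoint_bigcupl => p pE; exact: SW.
have dZs : [disjoint Zs & W1] by apply: disjoint_bigcupl => e eE; exact: ZW1.
exists (X2 :|: (Zs :|: Ss)); split.
- rewrite !disjointsUl dX2W (disjointWr _ dZs) ?subsetUl //=.
  by apply: disjointWr dSs; rewrite /W1 -setUA subsetUl.
- rewrite !disjointsUl disjoint_sym dX /=; apply/andP; split.
    by apply: disjointWr dZs; rewrite /W1 setUCA subsetUl.
  by apply: disjointWr dSs; rewrite /W1 -!setUA setUCA subsetUl.
- have := leq_cardsU X2 (Zs :|: Ss); have := leq_cardsU Zs Ss; move: cZs cSs cX2 k0; clear; nia.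
move=> R RX cR; have [f [injf fr fX]] := Hr R RX cR.
(* Off the matching an absorber is tiled alone; on a matching edge it takes in [x |: Z e], so every
   [Z e] and every vertex of [X2 :|: R] is used exactly once. *)
pose K' p := if p.2 == f p.1 then K p else set0.
have K'W p : p \in Ed -> K' p \subset W1 :|: Zs.
  move=> pE; rewrite /K'; case: ifP => _; last exact: sub0set.
  rewrite subUset sub1set inE W1X ?EdX //=; apply: subset_trans (subsetUr _ _).
  exact: (bigcup_sup p.1).
have -> : (X2 :|: (Zs :|: Ss)) :|: R = \bigcup_(p in Ed) (S p :|: K' p).
  have -> : (X2 :|: (Zs :|: Ss)) :|: R = (X2 :|: R) :|: (Zs :|: Ss) by set_ac.
  rewrite -fX; apply/eqP; rewrite eqEsubset; apply/andP; split; last first.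
    apply/bigcupsP => p pE; rewrite subUset; apply/andP; split.
      by rewrite setUA; apply: subset_trans (subsetUr _ _); exact: (bigcup_sup p).
    rewrite /K'; case: eqP => [e|_]; last exact: sub0set.
    rewrite subUset sub1set !inE {1}e imset_f //=.
    apply: subset_trans (subsetUr _ _); apply: subset_trans (subsetUl _ _).
    exact: (bigcup_sup p.1).
  have fE e : (e, f e) \in Ed by rewrite inE /= fr.
  rewrite !subUset; apply/and3P; split.
  - apply/subsetP => x /imsetP[e _ ->]; apply/bigcupP; exists (e, f e) => //.
    by rewrite /K' /= eqxx !inE eqxx orbT.
  - apply/subsetP => x /bigcupP[e _ xe]; apply/bigcupP; exists (e, f e) => //.
    by rewrite /K' /= eqxx !inE xe !orbT.
  - apply/bigcupsP => p pE; apply: (bigcup_max p) => //; exact: subsetUl.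
apply: tileable_bigcup => [p pE|p q pE qE pq].
  case: (SP p pE) => _ tS tSK; rewrite /K'; case: ifP => _ //.
  by rewrite setU0.
rewrite disjointsUl !disjointsUr SS //= (disjointWr (K'W q qE) (SW p pE)) /=.
rewrite disjoint_sym (disjointWr (K'W p pE) (SW q qE)) /=.
rewrite /K'; case: eqP => [ep|_]; last by rewrite -setI_eq0 set0I.
case: eqP => [eq|_]; last by rewrite -setI_eq0 setI0.
have pq1 : p.1 != q.1.
  apply: contraNneq pq => e; apply/eqP; case: p q e ep eq {pE qE} => [p1 p2] [q1 q2] /= -> -> ->.
  by [].
rewrite disjointU1s !inE negb_or Zx ?EdX // andbT ep eq (inj_eq injf) pq1 /=.
rewrite disjoint_sym disjointU1s Zx ?EdX //=.
by rewrite disjoint_sym ZZ // inE.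
Qed.

End Absorbing.

(** * Hitting sets and almost perfect tilings *)

Section Hitting.
Variable G : sgraph.
Implicit Types (x u v : G) (H U W X Y : {set G}).

Definition missed Y : {set G} := [set u | [disjoint nbr u & Y]].

(** By averaging, some [y] in [H] is adjacent to a [1/p] share of the vertices still missed, so [M]
    choices leave at most a share [(1 - 1/p)^M]. *)
Lemma hit_round H (p M : nat) :
  0 < p -> (forall u, #|G| <= p * #|nbr u :&: H|) ->
  exists Y, [/\ Y \subset H, #|Y| <= M & #|missed Y| * p ^ M <= #|G| * p.-1 ^ M].
Proof.
move=> p0 Hp; elim: M => [|M [Y [YH YM mY]]].
  by exists set0; rewrite sub0set cards0 !muln1 max_card.
have [m0|[u0 u0m]] := set_0Vmem (missed Y).
  by exists Y; rewrite m0 cards0 mul0n (leq_trans YM).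
have mY0 : 0 < #|missed Y| by apply/card_gt0P; exists u0.
have [y yH my] : exists2 y, y \in H & #|missed Y| <= p * #|nbr y :&: missed Y|.
  apply/exists_inP; apply: contraT => /exists_inPn no.
  have lo : #|missed Y| * #|G| <= p * \sum_(u in missed Y) #|nbr u :&: H|.
    rewrite -sum_nat_const big_distrr /=; apply: leq_sum => u _; exact: Hp.
  have up : p * \sum_(y in H) #|nbr y :&: missed Y| <= #|G| * #|missed Y|.-1.
    rewrite big_distrr /=; apply: leq_trans (_ : \sum_(y in H) #|missed Y|.-1 <= _).
      by apply: leq_sum => y /no; rewrite -ltnNge => h; slia.
    by rewrite sum_nat_const leq_mul2r max_card orbT.
  have G0 : 0 < #|G| by apply/card_gt0P; exists u0.
  move: lo up G0 mY0; rewrite sum_card_nbr; clear.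
  by case: (#|missed Y|) => // m /= lo up G0 _; have := leq_trans lo up; rewrite mulnC leq_mul2l ltnn orbF; case: #|G| G0.
exists (y |: Y); split.
- by rewrite subUset sub1set yH.
- by apply: leq_trans (leq_cards1U _ _) _.
have -> : missed (y |: Y) = missed Y :\: nbr y.
  by apply/setP => u; rewrite !inE disjoint_sym disjointU1s inE [adj y u]adj_sym [in RHS]disjoint_sym.
have := cardsID (nbr y) (missed Y); rewrite setIC => e.
have step : #|missed Y :\: nbr y| * p <= #|missed Y| * p.-1.
  move: my e p0; move: #|missed Y| #|missed Y :\: _| #|nbr y :&: _| => c1 c2 c3.
  by clear; case: p => // q /=; nia.
rewrite !expnS; move: mY step; move: (p ^ M) (p.-1 ^ M) (p.-1) #|missed Y| #|_ :\: _| #|G|.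
by clear => c d q m m' n h1 h2; nia.
Qed.

(** Bernoulli's inequality for [(1 + 1/q)^M] with [q = p - 1], cleared of denominators: [z * p]
    choices in [hit_round] leave at most a [1/z] share. *)
Lemma exp_pred_leq z p : 0 < p -> z * p.-1 ^ (z * p) <= p ^ (z * p).
Proof.
case: p => // q _ /=.
have bern M : q ^ M * (q + M) <= q * q.+1 ^ M.
  elim: M => [|M IH]; first by rewrite addn0 mul1n muln1.
  rewrite !expnS; move: IH; move: (q ^ M) (q.+1 ^ M) => c d; nia.
case: (posnP q) => [->|q0].
  by rewrite muln1; case: z => // z; rewrite exp0n // muln0.
rewrite -(leq_pmul2l q0); apply: leq_trans (bern _).
by rewrite mulnA [q * z]mulnC mulnC leq_mul2l; apply/orP; right; nia.
Qed.

(* s disjoint rounds, each of which misses at most a 1/z fraction. *)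
Lemma hitting_set H (p z s : nat) :
  0 < p -> 0 < s ->
  (forall u W, #|W| <= s * (z * p) -> #|G| <= p * #|nbr u :&: (H :\: W)|) ->
  exists X, [/\ X \subset H, #|X| <= s * (z * p) &
    z * #|[set u | 2 * #|nbr u :&: X| < s]| <= 2 * #|G|].
Proof.
move=> p0 s0 Hp.
have [||Y [YP Yt _ YY]] := @greedy_family _ _ [set: 'I_s]
    (fun _ S => S \subset H /\ z * #|missed S| <= #|G|) (z * p) (s * (z * p)) set0.
- move=> j W _ Ws; have [u|Y [YH YM mY]] := @hit_round (H :\: W) p (z * p) p0.
    exact: Hp.
  exists Y; split=> //.
    split; first exact: subset_trans YH (subsetDl _ _).
    have := exp_pred_leq z p0; move: mY.
    have : 0 < p ^ (z * p) by rewrite expn_gt0 p0.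
    move: (p ^ _) (p.-1 ^ _) #|missed Y| #|G| => c d m n c0 h1 h2.
    rewrite -(leq_pmul2r c0); nia.
  by apply: disjointWl YH _; rewrite disjoints_subset setDE subsetIr.
- by rewrite cards0 cardsT card_ord.
pose X := \bigcup_(j in [set: 'I_s]) Y j.
exists X; split.
- by apply/bigcupsP => j jS; case: (YP j jS).
- by rewrite -[s in s * _]card_ord -cardsT; exact: leq_card_bigcup.
set Bad := [set u | _].
(* A bad [u] is missed by at least half of the [s] disjoint rounds; counting pairs of a vertex and a
   round then gives the factor 2 of the statement. *)
have miss u : u \in Bad -> s <= 2 * #|[set: 'I_s] :&: [set j | u \in missed (Y j)]|.
  rewrite inE => lt.
  have hits : #|[set: 'I_s] :\: [set j | u \in missed (Y j)]| <= #|nbr u :&: X|.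
    rewrite -sum1_card; apply: leq_trans (_ : \sum_(j in [set: 'I_s]) #|nbr u :&: Y j| <= _).
      rewrite big_mkcond [leqRHS]big_mkcond /=; apply: leq_sum => j _.
      rewrite !inE andbT; case: ifP => // nd.
      by rewrite card_gt0 setI_eq0 nd.
    apply: leq_trans (bonferroni (g := 0) _) _.
      move=> i j iS jS ij; rewrite leqn0 cards_eq0 setI_eq0.
      exact: disjointW (subsetIr _ _) (subsetIr _ _) (YY i j iS jS ij).
    by rewrite muln0 addn0 -big_distrr.
  have := cardsID [set j | u \in missed (Y j)] [set: 'I_s].
  rewrite cardsT card_ord; lia.
have double : \sum_(u in Bad) #|[set: 'I_s] :&: [set j | u \in missed (Y j)]|
    <= \sum_(j in [set: 'I_s]) #|missed (Y j)|.
  apply: (@leq_trans (\sum_(u in Bad) \sum_(j in [set: 'I_s]) (u \in missed (Y j) : nat))).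
    apply: leq_sum => u _; rewrite -sum1_card big_mkcond [leqRHS]big_mkcond /=.
    by apply: leq_sum => j _; rewrite !inE; case: [disjoint _ & _].
  rewrite exchange_big /=; apply: leq_sum => j _.
  rewrite -sum1_card big_mkcond [leqRHS]big_mkcond /=; apply: leq_sum => u _.
  by rewrite !inE; case: ifP; case: [disjoint _ & _].
have lo : #|Bad| * s <= 2 * \sum_(u in Bad) #|[set: 'I_s] :&: [set j | u \in missed (Y j)]|.
  by rewrite -sum_nat_const big_distrr /=; apply: leq_sum => u; exact: miss.
have up : z * \sum_(j in [set: 'I_s]) #|missed (Y j)| <= s * #|G|.
  apply: (@leq_trans (\sum_(j in [set: 'I_s]) #|G|)); last by rewrite sum_nat_const cardsT card_ord.
  by rewrite big_distrr /=; apply: leq_sum => j jS; case: (YP j jS).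
rewrite -(leq_pmul2l s0).
by move: lo up double; move: (\sum_(_ in Bad) _) (\sum_(_ in [set: _]) _) => c d; nia.
Qed.

End Hitting.

(** * Almost perfect tilings from a maximum packing *)

Section NearTiling.
Variables (G : sgraph) (k a : nat).
Hypothesis k3 : 2 < k.
Hypothesis Ha : forall I : {set G}, independent I -> #|I| <= a.
Implicit Types (x u v : G) (B S U V W : {set G}) (P : {set {set G}}).

Definition packing V P : bool := trivIset P && [forall B in P, kcycle k B && (B \subset V)].

Lemma packingP V P :
  reflect (trivIset P /\ forall B, B \in P -> kcycle k B /\ B \subset V) (packing V P).
Proof.
apply: (iffP andP) => -[tP H]; split=> //.
  by move=> B BP; apply/andP; exact: (forall_inP H).
by apply/forall_inP => B BP; apply/andP; exact: H.
Qed.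

Lemma packingD V P B : packing V P -> packing V (P :\ B).
Proof.
move=> /packingP[tP H]; apply/packingP; split; last by move=> C /setD1P[_]; exact: H.
exact: trivIsetS (subD1set _ _) tP.
Qed.

Lemma packingU V P B : packing V P -> kcycle k B -> B \subset V -> [disjoint B & cover P] ->
  packing V (B |: P) /\ #|B |: P| = #|P|.+1.
Proof.
move=> /packingP[tP H] kB BV dB.
have sP C : C \in P -> C \subset cover P by move=> CP; exact: bigcup_sup.
have nB : B \notin P.
  apply/negP => /sP BP; have : B = set0 by apply/eqP; rewrite -(setIidPl BP) setI_eq0.
  by move=> B0; have := card_kcycle kB; rewrite B0 cards0; slia.
split; last by rewrite cardsU1 nB.
apply/packingP; split; last by move=> C /setU1P[->|/H].
apply/trivIsetP => C D /setU1P[->|CP] /setU1P[->|DP]; rewrite ?eqxx // => CD.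
- exact: disjointWr (sP _ DP) dB.
- by rewrite disjoint_sym; exact: disjointWr (sP _ CP) dB.
- exact: (trivIsetP tP).
Qed.

(* In a maximum packing no cycle has two vertices of large degree into the
   uncovered set: it could be traded for two stars closed to cycles. *)
Lemma near_tiling V (d : nat) :
  (forall x, x \in V -> d <= #|nbr x :&: V|) ->
  exists2 U : {set G}, U \subset V & tileable k (V :\: U) /\
    k * #|U| * (d - (k - 2) * a) <= #|V| * (#|U| + k * ((k - 2) * a + k)).
Proof.
move=> Hd.
have p0 : packing V set0.
  by apply/packingP; split=> [|B]; rewrite ?inE //; apply/trivIsetP => B C; rewrite inE.
case: (@arg_maxnP _ set0 (packing V) (fun P => #|P|) p0) => P pP maxP.
have /packingP[tP HP] := pP.
have covV : cover P \subset V by apply/bigcupsP => B /HP[].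
pose U := V :\: cover P.
have UV : U \subset V := subsetDl _ _.
have dU : [disjoint U & cover P] by rewrite disjoints_subset /U setDE subsetIr.
have VU : V :\: U = cover P by rewrite /U setDDr setDv set0U; apply/setIidPr.
exists U => //; split.
  rewrite VU; apply/tileableP; exists P; last by move=> B /HP[].
  apply/and3P; split=> //; apply/negP => /HP[/card_kcycle]; rewrite cards0; slia.
set D := (k - 2) * a.
have star u S : kcycle k S -> S \subset U -> False.
  move=> kS SU; have [pS cS] := packingU pP kS (subset_trans SU UV) (disjointWl SU dU).
  by have := maxP _ pS; rewrite cS /= => h; rewrite ltnn in h.
have degU u : u \in U -> #|nbr u :&: U| <= D.
  move=> uU; rewrite leqNgt; apply/negP => /(exists_star k3 Ha)[B [BU _ Bk]].
  apply: (star u (u |: B)); first by apply: Bk; exact: subset_trans BU (subsetIl _ _).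
  by rewrite subUset sub1set uU; exact: subset_trans BU (subsetIr _ _).
(* The margin [k] lets the second star avoid the first; trading [B] for the two cycles would gain
   one. *)
have two B x y : B \in P -> x \in B -> y \in B -> x != y ->
    D + k < #|nbr x :&: U| -> D + k < #|nbr y :&: U| -> False.
  move=> BP xB yB xy lx ly.
  have [|S1 [S1U cS1 kS1]] := exists_star (Z := nbr x :&: U) k3 Ha; first by rewrite -/D; slia.
  have [|S2 [S2U cS2 kS2]] := exists_star (Z := (nbr y :&: U) :\: S1) k3 Ha.
    by have := leq_cardD (nbr y :&: U) S1; rewrite -/D; slia.
  have s1U := subset_trans S1U (subsetIr _ _).
  have s2U : S2 \subset U := subset_trans S2U (subset_trans (subsetDl _ _) (subsetIr _ _)).
  have xV : x \in cover P by apply/bigcupP; exists B.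
  have yV : y \in cover P by apply/bigcupP; exists B.
  have xU : x \notin U by apply/negP => xU; exact: disjointF dU xU xV.
  have yU : y \notin U by apply/negP => yU; exact: disjointF dU yU yV.
  have nPB z : z \in B -> z \notin cover (P :\ B).
    move=> zB; apply/bigcupP => -[C /setD1P[CB CP] zC].
    exact: disjointF (trivIsetP tP _ _ CP BP CB) zC zB.
  have sPB : cover (P :\ B) \subset cover P.
    by apply/bigcupsP => C /setD1P[_ CP]; exact: bigcup_sup.
  have d1 : [disjoint S1 & cover (P :\ B)] := disjointW s1U sPB dU.
  have d2 : [disjoint S2 & cover (P :\ B)] := disjointW s2U sPB dU.
  have k1 : kcycle k (x |: S1) by apply: kS1; exact: subset_trans S1U (subsetIl _ _).
  have k2 : kcycle k (y |: S2).
    by apply: kS2; exact: subset_trans S2U (subset_trans (subsetDl _ _) (subsetIl _ _)).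
  have [||p1 c1] := packingU (packingD B pP) k1.
  - by rewrite subUset sub1set (subsetP covV) // (subset_trans s1U).
  - by rewrite disjointU1s nPB.
  have [||p2 c2] := packingU p1 k2.
  - by rewrite subUset sub1set (subsetP covV) // (subset_trans s2U).
  - rewrite /cover bigcup_setU big_set1 disjointU1s inE negb_or nPB // andbT.
    rewrite disjointsUr d2 andbT disjoint_sym disjointU1s.
    rewrite (_ : y \notin _ = true); last first.
      apply/negP => /setU1P[yx|/(subsetP s1U)]; last exact/negP.
      by rewrite yx eqxx in xy.
    have -> /= : x \notin S2 by apply: contra xU; exact: (subsetP s2U).
    by rewrite disjoint_sym; apply: disjointWl S2U _; rewrite disjoints_subset setDE subsetIr.
  by have := maxP _ p2; rewrite c2 c1 (cardsD1 B P) BP add1n /= ltnn.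
have tile B : B \in P -> \sum_(x in B) #|nbr x :&: U| <= #|U| + k * (D + k).
  move=> BP; have [/card_kcycle Bk _] := HP B BP.
  have [/exists_inP[x xB lx]|/exists_inPn no] := boolP [exists x in B, D + k < #|nbr x :&: U|].
    rewrite (bigD1 x) //=; apply: leq_add; first by rewrite subset_leq_card ?subsetIr.
    apply: leq_trans (_ : \sum_(y in B) (D + k) <= _); last by rewrite sum_nat_const Bk.
    rewrite big_mkcondr /=; apply: leq_sum => y yB; case: ifP => // yx.
    rewrite leqNgt; apply/negP => ly; apply: (two B x y) => //.
    by rewrite eq_sym yx.
  apply: leq_trans (leq_addl _ _); rewrite -{1}Bk -sum_nat_const; apply: leq_sum => x /no.
  by rewrite -leqNgt.
have cP : #|P| * k <= #|V|.
  apply: leq_trans (subset_leq_card covV).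
  have /eqP <- : \sum_(B in P) #|B| == #|cover P| by rewrite (eqP tP).
  by rewrite -sum_nat_const; apply: leq_sum => B /HP[/card_kcycle->].
have lo : #|U| * d <= #|U| * D + #|P| * (#|U| + k * (D + k)).
  apply: leq_trans (_ : \sum_(u in U) #|nbr u :&: V| <= _).
    by rewrite -sum_nat_const; apply: leq_sum => u /(subsetP UV); exact: Hd.
  apply: leq_trans (_ : \sum_(u in U) (#|nbr u :&: U| + #|nbr u :&: cover P|) <= _).
    apply: leq_sum => u _; rewrite -(cardsID U (nbr u :&: V)) -setIA (setIidPr UV) leq_add2l.
    by rewrite -VU -setIDA.
  rewrite big_split /=; apply: leq_add.
    by rewrite -sum_nat_const; apply: leq_sum => u; exact: degU.
  rewrite sum_card_nbr big_trivIset //= -sum_nat_const; apply: leq_sum => B; exact: tile.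
rewrite mulnBr leq_subLR; move: lo cP; rewrite -/D.
move: #|U| #|P| #|V| => cU cP cV; move: (k * (D + k)) => E; clear; nia.
Qed.

End NearTiling.

(** * Blocks with slack inside one core *)

Lemma card_bigcup_disjoint (J T : finType) (D : {set J}) (F : J -> {set T}) s :
  (forall j, j \in D -> #|F j| = s) ->
  (forall i j, i \in D -> j \in D -> i != j -> [disjoint F i & F j]) ->
  #|\bigcup_(j in D) F j| = #|D| * s.
Proof.
move=> Fs dF; apply/eqP; rewrite eqn_leq leq_card_bigcup /=; last by move=> j /Fs->.
have := @bonferroni _ _ D F 0; rewrite muln0 addn0 (eq_bigr (fun=> s)) // sum_nat_const; apply.
by move=> i j iD jD ij; rewrite leqn0 cards_eq0 setI_eq0; exact: dF.
Qed.

Section Flexible.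
Variables (G : sgraph) (k : nat).
Hypothesis k0 : 0 < k.
Implicit Types (x u v : G) (B C D K Q R S W X Y Z : {set G}).

(* The block X0 :|: B has slack: a set of disjoint k-cycles among its vertices
   compensates, up to fewer than k vertices, for the removal of any R. *)
Lemma flexible_block (w t g h : nat) C X0 W :
  {in C &, forall u v, u != v -> reach k w t u v} ->
  (forall W, #|W| <= w -> exists B, [/\ B \subset C, kcycle k B & [disjoint B & W]]) ->
  w <= #|C| -> 0 < g -> h = k * g -> X0 \subset C -> #|X0| <= h ->
  #|W| + (7 * h + 4 * h * k + 153 * h * (k * t.+1) + k * t.+2) <= w ->
  exists B, [/\ [disjoint B & W], [disjoint B & X0],
    #|B| <= 5 * h + 4 * h * k + 153 * h * (k * t.+1) &
    forall R, R \subset X0 -> #|R| + k <= h ->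
      exists S, [/\ S \subset (X0 :|: B) :\: R, tileable k S &
        #|((X0 :|: B) :\: R) :\: S| < k]].
Proof.
move=> cliq dense wC g0 hE X0C X0h Ww.
set T := k * t.+1 in Ww *.
have h0 : 0 < h by rewrite hE muln_gt0 k0.
(* Padding [X0] to exactly [h] vertices provides, together with the [g] cycles of [F], the [2 * h]
   prescribed vertices of the gadget. *)
have [|Pd PdC cPd] := @exists_subset_card _ (C :\: (W :|: X0)) (h - #|X0|).
  by have := leq_cardD C (W :|: X0); have := leq_cardsU W X0; slia.
have dPd : [disjoint Pd & W] /\ [disjoint Pd & X0].
  by apply/andP; rewrite -disjointsUr; apply: disjointWl PdC _; rewrite disjoints_subset setDE subsetIr.
case: dPd => dPW dPX.
pose X1 := X0 :|: Pd.
have cX1 : #|X1| = h.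
  rewrite cardsU (_ : _ :&: _ = set0) ?cards0 ?cPd; first by slia.
  by apply/eqP; rewrite setI_eq0 disjoint_sym.
have X1C : X1 \subset C by rewrite subUset X0C (subset_trans PdC) ?subsetDl.
have [||F [FP _ FW FF]] := @greedy_family _ _ [set: 'I_g]
    (fun _ B => B \subset C /\ kcycle k B) k w (W :|: X1).
- move=> j W' _ W'w; have [B [BC kB dB]] := dense W' W'w.
  by exists B; rewrite (card_kcycle kB).
- rewrite cardsT card_ord [g * k]mulnC -hE; have := leq_cardsU W X1; slia.
pose Fs (J : {set 'I_g}) := \bigcup_(j in J) F j.
have FC j : F j \subset C by case: (FP j (in_setT j)).
have kF j : kcycle k (F j) by case: (FP j (in_setT j)).
have cFs J : #|Fs J| = #|J| * k.
  apply: card_bigcup_disjoint => [j _|i j _ _ ij]; first exact: card_kcycle (kF j).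
  by apply: FF; rewrite ?inE.
have dFs J : [disjoint Fs J & W] /\ [disjoint Fs J & X1].
  apply/andP; rewrite -disjointsUr; apply: disjoint_bigcupl => j _.
  by apply: FW; rewrite inE.
have dFsFs (J J' : {set 'I_g}) : [disjoint J & J'] -> [disjoint Fs J & Fs J'].
  move=> dJ; apply: disjoint_bigcupl => i iJ; rewrite disjoint_sym; apply: disjoint_bigcupl => j jJ.
  apply: FF; rewrite ?inE //; apply: contraTneq iJ => <-.
  by apply/negP => jJ'; exact: disjointF dJ jJ' jJ.
have tFs J : tileable k (Fs J).
  apply: tileable_bigcup => [j _|i j _ _ ij]; first exact: tileable_kcycle.
  by apply: FF; rewrite ?inE.
pose X := X1 :|: Fs setT.
have cX : #|X| = 2 * h.
  rewrite cardsU (_ : _ :&: _ = set0) ?cards0 ?cX1 ?cFs ?cardsT ?card_ord; first by slia.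
  by apply/eqP; rewrite setI_eq0 disjoint_sym; case: (dFs setT).
have XC : X \subset C by rewrite subUset X1C; apply/bigcupsP => j _.
have [|||Q [dQW dQX cQ HQ]] := @exists_gadget G k k0 T (w - k * t.+2) h C X W _ _ h0 XC cX.
- move=> K W' KC Kk W'w; apply: (exists_absorber k0 cliq dense KC Kk); only_leq; nia.
- by only_leq; nia.
- by slia.
exists (Pd :|: (Fs setT :|: Q)); case: (dFs setT) => dFW dFX1; split.
- by rewrite !disjointsUl dPW dFW dQW.
- rewrite !disjointsUl dPX /= (disjointWr _ dFX1) ?subsetUl //.
  by apply: disjointWr dQX; rewrite /X /X1 -setUA subsetUl.
- have := leq_cardsU Pd (Fs setT :|: Q); have := leq_cardsU (Fs setT) Q.
  rewrite cFs cardsT card_ord cPd; slia.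
move=> R RX0 Rh.
(* The least number of cycles of [F] that make up for [R]. Their vertices go into [Y], which then
   has fewer than [k] vertices beyond the [h] that the gadget absorbs; the other cycles stand
   alone. *)
pose j0 := (#|R| + k.-1) %/ k.
have j0g : j0 <= g.
  by rewrite -(mulnK g k0) mulnC -hE; apply: leq_div2r; slia.
have [|J _ cJ] := @exists_subset_card _ [set: 'I_g] j0; first by rewrite cardsT card_ord.
have [j0R j0k] : #|R| <= j0 * k /\ j0 * k < #|R| + k.
  by have := divn_eq (#|R| + k.-1) k; have := ltn_pmod (#|R| + k.-1) k0; rewrite -/j0; slia.
have RX1 : R \subset X1 := subset_trans RX0 (subsetUl _ _).
pose Y := (X1 :\: R) :|: Fs J.
have cY : #|Y| = h - #|R| + j0 * k.
  rewrite cardsU (_ : _ :&: _ = set0) ?cards0 ?subn0 ?cFs ?cJ.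
    by rewrite cardsD (setIidPr RX1) cX1.
  apply/eqP; rewrite setI_eq0 disjoint_sym; case: (dFs J) => _.
  by apply: disjointWr; exact: subsetDl.
have [|Y' Y'Y cY'] := @exists_subset_card _ Y h; first by slia.
have FsS J' : Fs J' \subset Fs setT by apply/bigcupsP => j _; apply: (bigcup_sup j).
have YX : Y \subset X by rewrite subUset (subset_trans (subsetDl _ _)) ?subsetUl // (subset_trans (FsS J)) ?subsetUr.
exists ((Q :|: Y') :|: Fs (~: J)); split.
- have H Z : Z \subset X1 :|: (Fs setT :|: Q) -> [disjoint Z & R] ->
      Z \subset (X0 :|: (Pd :|: (Fs setT :|: Q))) :\: R.
    by move=> ZX dZ; rewrite subsetD dZ andbT setUA.
  have dXR Z : [disjoint Z & X1] -> [disjoint Z & R] by apply: disjointWr.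
  rewrite !subUset; apply/andP; split; [apply/andP; split|].
  + apply: H; first by rewrite setUA subsetUr.
    by apply: dXR; apply: disjointWr dQX; exact: subsetUl.
  + apply: subset_trans Y'Y _; rewrite subUset; apply/andP; split.
      apply: H; first exact: subset_trans (subsetDl _ _) (subsetUl _ _).
      by rewrite disjoints_subset setDE subsetIr.
    apply: H; last by apply: dXR; case: (dFs J).
    by apply: subset_trans (FsS J) _; rewrite setUCA subsetUl.
  + apply: H; last by apply: dXR; case: (dFs (~: J)).
    by apply: subset_trans (FsS _) _; rewrite setUCA subsetUl.
- apply: tileableU => //.
    rewrite disjointsUl; apply/andP; split.
      by apply: disjointWr dQX; exact: subset_trans (FsS _) (subsetUr _ _).
    apply: disjointWl Y'Y _; rewrite disjointsUl; apply/andP; split.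
      rewrite disjoint_sym; case: (dFs (~: J)) => _; apply: disjointWr; exact: subsetDl.
    by apply: dFsFs; rewrite disjoints_subset setCK.
  by apply: HQ => //; exact: subset_trans Y'Y YX.
apply: leq_ltn_trans (_ : #|Y :\: Y'| < k).
  apply: subset_leq_card; apply/subsetP => x; rewrite in_setD => /andP[].
  rewrite !in_setU !negb_or => /andP[/andP[xQ xY'] xF] /setDP[].
  rewrite !in_setU (negbTE xQ) orbF => xX xR.
  rewrite in_setD xY' in_setU in_setD xR /= in_setU.
  have [xF'|xF'] := boolP (x \in Fs setT); last by move: xX; rewrite (negbTE xF') orbF => ->.
  apply/orP; right; case/bigcupP: xF' => j _ xj.
  apply/bigcupP; exists j => //; apply: contraNT xF => jJ.
  by apply/bigcupP; exists j; rewrite // inE.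
by rewrite cardsD (setIidPr Y'Y) cY cY'; slia.
Qed.

End Flexible.

(** * Assembling the tiling *)

Section Assembly.
Variables (G : sgraph) (k a : nat).
Hypothesis k3 : 2 < k.
Hypothesis Ha : forall I : {set G}, independent I -> #|I| <= a.
Implicit Types (x u v : G) (B D K L Q R S W X Y Z : {set G}).

Lemma tileable_stars D (F : G -> {set G}) :
  (forall u, u \in D -> kcycle k (u |: F u)) ->
  (forall u, u \in D -> [disjoint F u & D]) ->
  (forall u v, u \in D -> v \in D -> u != v -> [disjoint F u & F v]) ->
  tileable k (D :|: \bigcup_(u in D) F u).
Proof.
move=> kF FD FF.
have -> : D :|: \bigcup_(u in D) F u = \bigcup_(u in D) (u |: F u).
  apply/setP => x; rewrite inE; apply/orP/bigcupP => [[xD|/bigcupP[u uD xu]]|[u uD]].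
  - by exists x; rewrite ?setU11.
  - by exists u; rewrite ?setU1r.
  - case/setU1P => [->|xu]; [by left|right]; apply/bigcupP; by exists u.
apply: tileable_bigcup => [u uD|u v uD vD uv].
  by apply: tileable_kcycle; [slia|exact: kF].
have nF x y : x \in D -> y \in D -> x \notin F y.
  by move=> xD yD; apply/negP => xF; exact: disjointF (FD y yD) xF xD.
rewrite disjointU1s !inE negb_or uv nF //= disjoint_sym disjointU1s nF //= disjoint_sym.
exact: FF.
Qed.

Lemma kcycle_star_avoiding u A W :
  #|W| + (k - 2) * a < #|nbr u :&: A| ->
  exists S, [/\ S \subset A, #|S| = k.-1, kcycle k (u |: S) & [disjoint S & W]].
Proof.
move=> lt; have [|S [SZ Sk kS]] := exists_star (Z := (nbr u :&: A) :\: W) k3 Ha.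
  by have := leq_cardD (nbr u :&: A) W; slia.
exists S; split=> //.
- exact: subset_trans SZ (subset_trans (subsetDl _ _) (subsetIr _ _)).
- by apply: kS; exact: subset_trans SZ (subset_trans (subsetDl _ _) (subsetIl _ _)).
- by apply: disjointWl SZ _; rewrite disjoints_subset setDE subsetIr.
Qed.

(** The vertices of [Bad] outside the blocks are covered first, by cycles avoiding the blocks, so
    every vertex of [L] has at least [s / 2] neighbours in [X]. The lower bounds on [s] and [h] say
    that the stars of all of [L] fit disjointly into [X], and that their union [R] leaves the margin
    [k] required by [flexible_block]. *)
Lemma assemble (m w t g h s l delta : nat) (I : {set G}) (C : G -> {set G}) X :
  let bs := 5 * h + 4 * h * k + 153 * h * (k * t.+1) in
  let Bad := [set u | 2 * #|nbr u :&: X| < s] in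
  (forall x, delta <= #|nbr x|) ->
  #|I| <= m ->
  {in I &, forall i j, i != j -> [disjoint C i & C j]} ->
  {in I, forall i, {in C i &, forall u v, u != v -> reach k w t u v}} ->
  {in I, forall i, w <= #|C i| /\ forall W, #|W| <= w ->
     exists B, [/\ B \subset C i, kcycle k B & [disjoint B & W]]} ->
  X \subset \bigcup_(i in I) C i -> #|X| <= h -> 0 < g -> h = k * g ->
  h + m * bs + (7 * h + 4 * h * k + 153 * h * (k * t.+1) + k * t.+2) <= w ->
  #|Bad| * k <= w ->
  2 * w + (k - 2) * a < delta ->
  (forall l', k * l' * (delta - 2 * w - (k - 2) * a) <= #|G| * (l' + k * ((k - 2) * a + k)) ->
     l' <= l) ->
  2 * (l * k.-1 + m * ((k - 2) * a)) < s ->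
  l * k.-1 + k <= h ->
  exists2 S : {set G}, tileable k S & #|~: S| <= m * k.-1.
Proof.
move=> bs Bad Hd Im CC cliq dense XC Xh g0 hE N1 N2 N3 N4 N5 N6.
have k0 : 0 < k by slia.
pose X0 i := X :&: C i.
have [||B [BP Bbs BX BB]] := @greedy_family _ _ I (fun i B => [disjoint B & X0 i] /\
    forall R, R \subset X0 i -> #|R| + k <= h ->
      exists S, [/\ S \subset (X0 i :|: B) :\: R, tileable k S &
        #|((X0 i :|: B) :\: R) :\: S| < k]) bs (h + m * bs) X.
- move=> i W iI Wh; have [wC dC] := dense i iI.
  have [||B [BW BX cB HB]] := flexible_block k0 (X0 := X0 i) (W := W) (cliq i iI) dC wC g0 hE (subsetIr _ _).
  + exact: leq_trans (subset_leq_card (subsetIl _ _)) Xh.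
  + by apply: leq_trans N1; rewrite leq_add2r.
  by exists B.
- by apply: leq_add => //; rewrite leq_mul2r Im orbT.
pose Block i := X0 i :|: B i.
pose Struct := \bigcup_(i in I) Block i.
have XS : X \subset Struct.
  apply/subsetP => x xX; have /bigcupP[i iI xC] := subsetP XC x xX.
  by apply/bigcupP; exists i; rewrite // !inE xX xC.
have cStruct : #|Struct| <= w.
  have sub : Struct \subset X :|: \bigcup_(i in I) B i.
    apply/bigcupsP => i iI; apply: setUSS; first exact: subsetIl.
    exact: (bigcup_sup i).
  apply: leq_trans (subset_leq_card sub) _; apply: leq_trans (leq_cardsU _ _) _.
  have := leq_card_bigcup Bbs; have : #|I| * bs <= m * bs by rewrite leq_mul2r Im orbT.
  by move: Xh N1; clear; lia.
have bad_nbr W u : #|W| <= 2 * w -> exists S, [/\ S \subset [set: G], #|S| = k.-1,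
    kcycle k (u |: S) & [disjoint S & W]].
  move=> Ww; apply: kcycle_star_avoiding; rewrite setIT.
  by have := Hd u; slia.
pose D := Bad :\: Struct.
have cD : #|D| <= #|Bad| := subset_leq_card (subsetDl _ _).
have [||F [FP Fk FW FF]] := @greedy_family _ _ D (fun u S => kcycle k (u |: S)) k.-1 (2 * w)
    (Struct :|: Bad).
- move=> u W _ Ww; have [S [_ cS kS dS]] := bad_nbr W u Ww.
  by exists S; rewrite cS.
- have := leq_cardsU Struct Bad; move: cStruct N2 cD k0; clear; move: #|Struct :|: Bad| => c; only_leq; nia.
pose BS := D :|: \bigcup_(u in D) F u.
have tBS : tileable k BS.
  apply: tileable_stars => // u uD.
  by apply: disjointWr (FW u uD); rewrite (subset_trans (subsetDl _ _)) ?subsetUr.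
have dBS : [disjoint BS & Struct].
  rewrite disjointsUl; apply/andP; split; first by rewrite disjoints_subset /D setDE subsetIr.
  apply: disjoint_bigcupl => u uD; apply: disjointWr (FW u uD); exact: subsetUl.
have cBS : #|BS| <= w.
  apply: leq_trans (leq_cardsU _ _) _; have := leq_card_bigcup Fk.
  by move: N2 cD k0; clear; nia.
pose V0 := ~: (Struct :|: BS).
have [x _|L LV [tT0 HL]] := @near_tiling G k a k3 Ha V0 (delta - 2 * w).
  have := leq_cardD (nbr x) (Struct :|: BS); rewrite setDE -/V0.
  by have := Hd x; have := leq_cardsU Struct BS; move: cStruct cBS; clear; lia.
have {HL} cL : #|L| <= l.
  by apply: N4; apply: leq_trans HL _; rewrite leq_mul2r max_card orbT.
have dV0 : [disjoint V0 & Struct :|: BS] by rewrite disjoint_sym disjoints_subset setCK.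
have /andP[dV0S dV0B] : [disjoint V0 & Struct] && [disjoint V0 & BS] by rewrite -disjointsUr.
have [||F' [F'P F'k _ F'F']] := @greedy_family _ _ L
    (fun u S => kcycle k (u |: S) /\ S \subset X) k.-1 (l * k.-1) set0.
- move=> u W uL Ww.
  have nBad : u \notin Bad.
    apply/negP => uBad; have uV := subsetP LV u uL.
    have uS : u \notin Struct by apply/negP; exact: disjointF dV0S uV.
    have uBS : u \in BS by rewrite in_setU in_setD uS uBad.
    exact: disjointF dV0B uV uBS.
  have {nBad} lt : s <= 2 * #|nbr u :&: X| by move: nBad; rewrite inE -leqNgt.
  have [i iI lti] : exists2 i, i \in I & (k - 2) * a < #|(nbr u :&: (X :\: W)) :&: C i|.
    apply/exists_inP; apply: contraT => /exists_inPn no.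
    have sub : nbr u :&: (X :\: W) \subset \bigcup_(i in I) ((nbr u :&: (X :\: W)) :&: C i).
      rewrite -big_distrr /= subsetI subxx /=; apply: subset_trans (subsetIr _ _) _.
      exact: subset_trans (subsetDl _ _) XC.
    have : #|nbr u :&: (X :\: W)| <= #|I| * ((k - 2) * a).
      apply: leq_trans (subset_leq_card sub) _; apply: leq_card_bigcup => i /no.
      by rewrite -leqNgt.
    have := leq_cardD (nbr u :&: X) W; rewrite -setIDA.
    have : #|I| * ((k - 2) * a) <= m * ((k - 2) * a) by rewrite leq_mul2r Im orbT.
    by move: lt N5 Ww; clear; move: (m * _) (#|I| * _) => c1 c2; slia.
  have [|S [SA cS kS dS]] := @kcycle_star_avoiding u ((X :\: W) :&: C i) set0.
    by rewrite cards0 add0n setIA.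
  have SXW := subset_trans SA (subsetIl _ _).
  exists S; rewrite cS; split=> //.
    by split=> //; exact: subset_trans SXW (subsetDl _ _).
  by apply: disjointWl SXW _; rewrite disjoints_subset setDE subsetIr.
- by rewrite cards0 leq_mul2r cL orbT.
pose R := \bigcup_(u in L) F' u.
have RX : R \subset X by apply/bigcupsP => u uL; case: (F'P u uL).
have cR : #|R| <= l * k.-1.
  by apply: leq_trans (leq_card_bigcup F'k) _; rewrite leq_mul2r cL orbT.
have dLS : [disjoint L & Struct] := disjointWl LV dV0S.
have tLR : tileable k (L :|: R).
  apply: tileable_stars => // u uL; first by case: (F'P u uL).
  case: (F'P u uL) => _ F'X; rewrite disjoint_sym; apply: disjointWr dLS.
  exact: subset_trans F'X XS.
have [E HE] : exists E : G -> {set G}, forall i, i \in I ->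
    [/\ E i \subset Block i :\: (R :&: C i), tileable k (E i) &
      #|(Block i :\: (R :&: C i)) :\: E i| < k].
  apply: (@fin_all_exists _ _ (fun i S => i \in I -> [/\ S \subset Block i :\: (R :&: C i), tileable k S &
      #|(Block i :\: (R :&: C i)) :\: S| < k])) => i.
  case: (boolP (i \in I)) => [iI|_]; last by exists set0.
  case: (BP i iI) => _ /(_ (R :&: C i)) []; first exact: setSI.
    by have := subset_leq_card (subsetIl R (C i)); slia.
  by move=> S HS; exists S.
have dBl i j : i \in I -> j \in I -> i != j -> [disjoint Block i & Block j].
  move=> iI jI ij; rewrite disjointsUl !disjointsUr BB // andbT.
  rewrite (disjointW (subsetIr _ _) (subsetIr _ _) (CC i j iI jI ij)) /=.
  rewrite (disjointWr (subsetIl _ _) (BX i iI)) andbT disjoint_sym.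
  exact: disjointWr (subsetIl _ _) (BX j jI).
pose Es := \bigcup_(i in I) E i.
have EBl i : i \in I -> E i \subset Block i.
  by move=> iI; case: (HE i iI) => Ei _ _; exact: subset_trans Ei (subsetDl _ _).
have tEs : tileable k Es.
  apply: tileable_bigcup => [i iI|i j iI jI ij]; first by case: (HE i iI).
  by apply: disjointW (EBl i iI) (EBl j jI) _; exact: dBl.
have EsS : Es \subset Struct.
  by apply/bigcupsP => i iI; apply: subset_trans (EBl i iI) _; exact: (bigcup_sup i).
have dREs : [disjoint R & Es].
  rewrite disjoint_sym; apply: disjoint_bigcupl => i iI; apply/disjointP => x xE xR.
  case: (HE i iI) => Ei _ _; have := subsetP Ei x xE.
  rewrite !inE xR /= => /andP[xC] /orP[/andP[_ xC']|xB]; first by rewrite xC' in xC.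
  exact: disjointF (BX i iI) xB (subsetP RX x xR).
have RS := subset_trans RX XS.
exists (((V0 :\: L) :|: BS) :|: ((L :|: R) :|: Es)).
  apply: tileableU; first last.
  - apply: tileableU => //; rewrite disjointsUl dREs andbT.
    exact: disjointWr EsS dLS.
  - apply: tileableU => //; exact: disjointWl (subsetDl _ _) dV0B.
  have dT0 Y : Y \subset Struct -> [disjoint V0 :\: L & Y].
    by move=> YS; exact: disjointW (subsetDl _ _) YS dV0S.
  have dBS' Y : Y \subset Struct -> [disjoint BS & Y] by move=> YS; exact: disjointWr YS dBS.
  rewrite disjointsUl !disjointsUr (dT0 R RS) (dT0 Es EsS) (dBS' R RS) (dBS' Es EsS) !andbT.
  rewrite disjoints_subset setDE subsetIr /= disjoint_sym.
  exact: disjointWl LV dV0B.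
(* Whatever is missed lies in a block, outside [R] and outside the tiled part [E i]. *)
apply: leq_trans (_ : #|\bigcup_(i in I) ((Block i :\: (R :&: C i)) :\: E i)| <= _).
  apply: subset_leq_card; apply/subsetP => x; rewrite in_setC !in_setU in_setD !negb_or.
  case/and3P=> /andP[xT xB] /andP[xL xR] xE.
  have : x \in Struct.
    apply: contraR xT => xS; rewrite xL /= in_setC in_setU negb_or xS /=.
    by rewrite in_setU negb_or.
  case/bigcupP => i iI xi; apply/bigcupP; exists i => //.
  rewrite in_setD in_setD xi andbT in_setI (negbTE xR) /= andbT.
  by apply: contra xE => xE; apply/bigcupP; exists i.
apply: leq_trans (leq_card_bigcup (t := k.-1) _) _; last by rewrite leq_mul2r Im orbT.
by move=> i iI; case: (HE i iI) => _ _; case: (k) k0.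
Qed.

End Assembly.

(** * Choice of the constants *)

(** Connector sizes of successive levels: the start comes from [reach_common_nbr], the recursion
    from [reach_merge]. *)
Definition level_size (k j : nat) : nat := iter j (fun t => 2 * k + k.+1 * t) k.-1.

Lemma leq_level_size k i j : i <= j -> level_size k i <= level_size k j.
Proof.
move=> ij; rewrite -(subnK ij); elim: (j - i) => // d IH.
by apply: leq_trans IH _; rewrite /level_size addSn iterS mulSn; lia.
Qed.

(** The sizes are measured in units of [r], a constant fraction of [n]; the factor [b] between [r]
    and the degrees into a core dominates the error terms. *)
Lemma exists_structure (k m c : nat) (G : sgraph) (a delta r : nat) :
  let b := 100 * c * k ^ 3 in
  let n := #|G| in
  let t := level_size k m in
  2 < k -> 0 < m -> m < k -> 0 < c ->
  (forall I : {set G}, independent I -> #|I| <= a) ->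
  (forall x : G, delta <= #|nbr x|) ->
  n * c.+1 <= c * (m.+1 * delta) ->
  4 * k * m * b * r <= n -> n <= 8 * k * m * b * r ->
  m * (k.+1 * t.+2) + 8 * k * m + k + 2 <= r -> 16 * k * m * a <= r ->
  exists (I : {set G}) (C : G -> {set G}),
    [/\ #|I| <= m,
        {in I &, forall i j, i != j -> [disjoint C i & C j]},
        #|~: \bigcup_(i in I) C i| <= 8 * m ^ 2 * r,
        {in I, forall i, {in C i &, forall u v, u != v -> reach k r t u v}} &
        {in I, forall i, r <= #|C i| /\ forall W : {set G}, #|W| <= r ->
          exists B : {set G}, [/\ B \subset C i, kcycle k B & [disjoint B & W]]}].
Proof.
move=> b n t k3 m0 mk c0 Ha Hd F1 nlo nhi rbig ar.
pose kap := k.+1 * t.+2.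
(* Each level gives up [kap], the cost of [k + 1] connectors; as [m * kap <= r], all levels stay
   between [r] and [2 * r]. *)
pose wl j := r + (m - j) * kap.
pose tl := level_size k.
have r0 : 0 < r by lia.
have bk : 100 * k <= b.
  rewrite /b -mulnA leq_mul2l /=; rewrite !expnS expn0 muln1.
  by apply: leq_trans (leq_pmull _ c0); rewrite leq_pmulr //; clear -k3; nia.
have kd : n <= k * delta.
  have H : n * c.+1 <= c * (k * delta).
    by apply: leq_trans F1 _; rewrite leq_mul2l leq_mul2r mk !orbT.
  by move: H c0; clear; move: (k * delta) => X; nia.
have dlo : 4 * m * b * r <= delta.
  rewrite -(@leq_pmul2l k); last by lia.
  by apply: leq_trans kd; apply: leq_trans nlo; rewrite !mulnA [k * 4]mulnC.
have ar' : a <= r.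
  by apply: leq_trans ar; rewrite leq_pmull // !muln_gt0 /= m0; lia.
have kapr : m * kap <= r by rewrite /kap; lia.
have n0 : 0 < n.
  by apply: leq_trans nlo; have : 0 < k by [lia]; have : 0 < b by [lia]; rewrite !muln_gt0 m0 r0 => -> ->.
have [D Dm|j [D [jm Dm unr Dmax]]] := @extremal_unreached G k m wl tl m0 n0.
  (* The degrees of [m + 1] vertices sum to at least [n + n / c], while the overlaps count for at
     most [k ^ 3 * r < n / c]; hence the factor [c * k ^ 3] in [b]. *)
  apply: (@not_unreached_max G k a delta k3 Ha Hd m.+1 _ D _ Dm); rewrite -/n.
  have H1 : wl 0 + (k - 2) * a <= k * r.
    rewrite /wl subn0; apply: (@leq_trans (2 * r + (k - 2) * r)).
      by apply: leq_add; [lia|rewrite leq_mul2l ar' orbT].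
    by rewrite -mulnDl leq_mul2r; apply/orP; right; lia.
  have H2 : m.+1 ^ 2 * (wl 0 + (k - 2) * a) <= k ^ 3 * r.
    apply: leq_trans (leq_mul (leqnn _) H1) _; rewrite mulnA (expnSr k 2) leq_mul2r.
    by apply/orP; right; rewrite leq_mul2r leq_sqr mk orbT.
  have H3 : c * (k ^ 3 * r) < n.
    apply: leq_trans nlo.
    have -> : 4 * k * m * b * r = (c * (k ^ 3 * r)) * (400 * (k * m)) by rewrite /b; ring.
    apply: ltn_Pmulr; first by have : 0 < k * m; [rewrite muln_gt0 m0; lia|lia].
    by rewrite !muln_gt0 c0 r0 ?expn_gt0 /=; lia.
  rewrite -(ltn_pmul2l c0); apply: leq_trans F1.
  have := leq_mul (leqnn c) H2; move: H3; move: (m.+1 ^ 2 * _) (k ^ 3 * r) => X Y; clear; lia.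
have wj : wl j.+1 <= wl j by rewrite /wl leq_add2l leq_mul2r leq_sub2l ?orbT.
have wj2 : wl j.+1 <= 2 * r.
  rewrite /wl mul2n -addnn leq_add2l; apply: leq_trans kapr.
  by rewrite leq_mul2r leq_subr orbT.
have rw i : r <= wl i by rewrite /wl leq_addr.
have cDm : #|D| <= m by rewrite Dm leq_subr.
have tj : tl j <= t by apply: leq_level_size; exact: ltnW.
(* Here [q = 4 * r] exceeds [p + wW] and [e = m * q]; [m * y] takes half of the lower bound on
   [delta], and [p = 8 * k * m] makes [p * y] twice the upper bound on [n]. *)
have [||||||||I [C [Im CC exC cliq dense]]] :=
  @dense_cores G k a delta k3 Ha Hd m (wl j) (wl j.+1) (tl j) (tl j.+1)
    (4 * m * r) (4 * r) (2 * b * r) (8 * k * m) D cDm unr Dmax.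
- by rewrite leqnn.
- apply: (@leq_trans (wl j.+1 + kap)).
    by rewrite leq_add2l leq_mul2l ltnS ltnS tj orbT.
  by rewrite /wl -addnA leq_add2l -mulSnr leq_mul2r; apply/orP; right; lia.
- apply: leq_trans dlo.
  have H : m + m ^ 2 * (wl j.+1).+2 + m * (4 * m * r) <= 8 * m ^ 2 * r.
    have H1 : m ^ 2 * (wl j.+1).+2 <= m ^ 2 * (3 * r) by rewrite leq_mul2l; apply/orP; right; lia.
    have H2 : m <= m ^ 2 * r.
      by rewrite -mulnA leq_pmulr // muln_gt0 m0.
    by move: H1 H2; rewrite -mulnn; clear; lia.
  have Hb : 4 * m <= b by lia.
  have : 4 * m * (2 * m * r) <= b * (2 * m * r) by rewrite leq_mul2r Hb orbT.
  by move: H; rewrite -mulnn; clear; lia.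
- by clear; lia.
- by lia.
- have H : (k - 2) * a <= k * r by apply: leq_mul; lia.
  have Hb : (k + 3) * r < b * r by rewrite ltn_pmul2r //; lia.
  by move: H Hb wj2 rbig; clear; lia.
- have H : (8 * k * m) ^ 2 * ((k - 2) * a) <= 4 * k ^ 2 * m * r.
    apply: (@leq_trans ((8 * k * m) ^ 2 * (k * a))).
      by rewrite leq_mul2l leq_mul2r leq_subr !orbT.
    have -> : (8 * k * m) ^ 2 * (k * a) = (4 * k ^ 2 * m) * (16 * k * m * a) by ring.
    by rewrite leq_mul2l ar orbT.
  have H' : 8 * k * m * ((2 * b - 3) * r) <= 8 * k * m * (2 * b * r - (wl j.+1 + k + 2)).
    by rewrite leq_mul2l; apply/orP; right; rewrite mulnBl; lia.
  apply: leq_trans H'; apply: leq_ltn_trans (leq_add nhi H) _.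
  have -> : 8 * k * m * b * r + 4 * k ^ 2 * m * r = (4 * k * m * r) * (2 * b + k) by ring.
  have -> : 8 * k * m * ((2 * b - 3) * r) = (4 * k * m * r) * (2 * (2 * b - 3)) by ring.
  by rewrite ltn_pmul2l; [lia|rewrite !muln_gt0 m0 r0 /=; lia].
- have H : r * ((2 * b - 3) * r) <= (4 * r - (wl j.+1 + k + 2)) * (2 * b * r - (wl j.+1 + k + 2)).
    by apply: leq_mul; [lia|rewrite mulnBl; lia].
  apply: leq_trans H; rewrite -(@ltn_pmul2l 2) //.
  have H1 : 2 * (n * a) <= b * r * r.
    apply: (@leq_trans (2 * (8 * k * m * b * r * a))); first by rewrite leq_mul2l leq_mul2r nhi orbT.
    have -> : 2 * (8 * k * m * b * r * a) = b * r * (16 * k * m * a) by ring.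
    by rewrite leq_mul2l ar orbT.
  apply: leq_ltn_trans H1 _.
  have -> : 2 * (r * ((2 * b - 3) * r)) = 2 * (2 * b - 3) * r * r by ring.
  by rewrite !ltn_pmul2r //; lia.
exists I, C; split=> //.
- apply: leq_trans exC _.
  have H1 : m ^ 2 * (wl j.+1).+2 <= m ^ 2 * (3 * r) by rewrite leq_mul2l; apply/orP; right; lia.
  have H2 : m <= m ^ 2 * r by rewrite -mulnA leq_pmulr // muln_gt0 m0.
  by move: H1 H2; rewrite -mulnn; clear; lia.
- move=> i iI u v uC vC uv; apply: (reach_mono (rw j) tj); exact: (cliq i iI u v uC vC uv).
move=> i iI; have [eC dC] := dense i iI; split.
  by apply: leq_trans eC; rewrite leq_pmull // muln_gt0 m0.
move=> W Wr; apply: dC; exact: leq_trans (rw _).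
Qed.

(** [k * delta] exceeds [n] by at least [n / c]; the losses [2 * r] and [(k - 2) * a] use up at most
    half of this surplus, whence the factor [2 * c]. *)
Lemma near_tiling_bound (k c n a delta r l : nat) :
  2 < k -> 0 < c -> 0 < n -> n * c.+1 <= c * (k * delta) ->
  a <= r -> 6 * c * k ^ 2 * r <= n ->
  k * l * (delta - 2 * r - (k - 2) * a) <= n * (l + k * ((k - 2) * a + k)) ->
  l <= 2 * c * k * ((k - 2) * a + k).
Proof.
move=> k3 c0 n0 F1 ar rn H.
set E := (k - 2) * a + k in H *.
set X := delta - 2 * r - (k - 2) * a in H.
have Hd : delta <= X + k * r.
  have : (k - 2) * a <= (k - 2) * r by rewrite leq_mul2l ar orbT.
  have : 2 * r + (k - 2) * r = k * r by rewrite -mulnDl; congr (_ * _); lia.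
  by rewrite /X; lia.
have H1 : n * c.*2.+1 <= 2 * c * (k * X).
  have h1 : c * (k * delta) <= c * (k * (X + k * r)) by rewrite !leq_mul.
  have e : c * (k * (X + k * r)) = c * (k * X) + c * k ^ 2 * r by ring.
  have h2 : 2 * (c * k ^ 2 * r) <= n.
    by apply: leq_trans rn; rewrite -!mulnA leq_mul.
  rewrite e in h1; rewrite -[2 * c * _]mulnA -mul2n mulnS; move: F1 h1 h2; rewrite mulnS.
  by move: (c * (k * X)) (c * (k * delta)) (c * k ^ 2 * r) => y y' v; clear; lia.
rewrite -(leq_pmul2l n0) -(leq_add2l (n * c.*2 * l)).
have -> : n * c.*2 * l + n * (2 * c * k * E) = 2 * c * (n * (l + k * E)) by rewrite -mul2n; ring.
apply: (@leq_trans (2 * c * (k * l * X))); last by rewrite leq_mul2l H orbT.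
have -> : 2 * c * (k * l * X) = 2 * c * (k * X) * l by ring.
have -> : n * c.*2 * l + n * l = n * c.*2.+1 * l by ring.
by rewrite leq_mul2r H1 orbT.
Qed.

Lemma leq_double_divn n d : 0 < d -> d <= n -> n <= 2 * (d * (n %/ d)).
Proof.
move=> d0 dn; have := divn_eq n d; have := ltn_pmod n d0.
have : 0 < n %/ d by rewrite divn_gt0.
move: (n %/ d) (n %% d) => q r; clear; nia.
Qed.

(* The hierarchy is a << s << h = s * M << r << n. *)
Lemma quasi_tiling (k m c : nat) : 2 < k -> 0 < m -> m < k -> 0 < c ->
  exists K N : nat, 0 < K /\ forall (G : sgraph) (a delta : nat),
    N <= #|G| ->
    (forall I : {set G}, independent I -> #|I| <= a) ->
    (forall x : G, delta <= #|nbr x|) ->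
    #|G| * c.+1 <= c * (m.+1 * delta) ->
    K * a <= #|G| ->
    exists2 S : {set G}, tileable k S & #|~: S| <= m * k.-1.
Proof.
move=> k3 m0 mk c0.
(* Ratios of consecutive scales: [n / r] is about [Bg], [r / s] about [A * M], and [s / a] at least
   [q]. [A] adds up the cost of the blocks per unit of [h]. *)
have [b bE] : exists x, x = 100 * c * k ^ 3 by eexists.
have [Bg BgE] : exists x, x = 4 * k * m * b by eexists.
pose t := level_size k m.
have [T TE] : exists x, x = k * t.+1 by eexists.
have [A AE] : exists x, x = 8 + m * (5 + 4 * k + 153 * T) + 4 * k + 153 * T + k * t.+2 by eexists.
have [z zE] : exists x, x = 4 * Bg * k by eexists.
have [M ME] : exists x, x = z * (4 * k) by eexists.
have [q qE] : exists x, x = 16 * c * k ^ 3 by eexists.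
have [r0 r0E] : exists x, x = m * (k.+1 * t.+2) + 8 * k * m + k + 2 by eexists.
have k0 : 0 < k by lia.
have kk : 0 < k ^ 3 by rewrite expn_gt0 k0.
have b0 : 0 < b by rewrite bE !muln_gt0 c0 ?kk ?k0.
have Bg0 : 0 < Bg by rewrite BgE muln_gt0 b0 !muln_gt0 k0 m0.
have A0 : 0 < A by rewrite AE -!addnA.
have z0 : 0 < z by rewrite zE muln_gt0 k0 muln_gt0 Bg0.
have M0 : 0 < M by rewrite ME muln_gt0 z0 muln_gt0 k0.
have q0 : 0 < q by rewrite qE !muln_gt0 c0 ?kk ?k0.
have AM0 : 0 < A * M by rewrite muln_gt0 A0.
(* The two roundings give [n <= 4 * (Bg * (A * M)) * s], so [K * a <= n] yields [q * a <= s]. *)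
exists (4 * (Bg * (A * M)) * q), (Bg * (A * M * (r0 + q))); split.
  by rewrite muln_gt0 q0 muln_gt0 muln_gt0 Bg0 AM0.
move=> G a delta nN Ha Hd F1 Ka.
set n := #|G| in nN F1 Ka *.
have [r rE] : exists x, x = n %/ Bg by eexists.
have [s sE] : exists x, x = r %/ (A * M) by eexists.
have rlo : A * M * (r0 + q) <= r by rewrite rE -(mulKn (A * M * _) Bg0); apply: leq_div2r.
have slo : r0 + q <= s by rewrite sE -(mulKn (r0 + q) AM0); apply: leq_div2r.
have rn : Bg * r <= n by rewrite rE mulnC leq_divM.
have sr : A * M * s <= r by rewrite sE mulnC leq_divM.
have r_pos : 0 < r by apply: leq_trans rlo; rewrite muln_gt0 AM0 addn_gt0 q0 orbT.
have s_pos : 0 < s by apply: leq_trans slo; rewrite addn_gt0 q0 orbT.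
have nr : n <= 2 * (Bg * r).
  by rewrite {1}rE; apply: leq_double_divn; rewrite // (leq_trans _ rn) // leq_pmulr.
have rs : r <= 2 * (A * M * s).
  by rewrite {1}sE; apply: leq_double_divn; rewrite // (leq_trans _ sr) // leq_pmulr.
have qa : q * a <= s.
  rewrite -(@leq_pmul2l (4 * (Bg * (A * M)))); last by rewrite muln_gt0 muln_gt0 Bg0 AM0.
  rewrite mulnA; apply: leq_trans Ka _; apply: leq_trans nr _.
  have : 2 * (Bg * r) <= 2 * (Bg * (2 * (A * M * s))) by rewrite !leq_mul2l rs !orbT.
  by move=> h; apply: leq_trans h _; apply: eq_leq; ring.
have s_r : s <= r.
  by apply: leq_trans sr; rewrite leq_pmull.
have kmq : 16 * k * m <= q.
  rewrite qE -!mulnA leq_mul2l /=; apply: leq_trans (leq_pmull _ c0).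
  rewrite expnS leq_mul2l; apply/orP; right; apply: leq_trans (ltnW mk) _.
  by rewrite -{1}(expn1 k) leq_pexp2l.
have ar : 16 * k * m * a <= r.
  by apply: leq_trans s_r; apply: leq_trans qa; rewrite leq_mul2r kmq orbT.
have a_r : a <= r.
  by apply: leq_trans ar; rewrite leq_pmull // !muln_gt0 k0 m0.
have Bgc : 400 * (c * k ^ 4 * m) = Bg by rewrite BgE bE; ring.
have n0 : 0 < n by apply: leq_trans rn; rewrite muln_gt0 Bg0.
have F1' : n * c.+1 <= c * (k * delta).
  by apply: leq_trans F1 _; rewrite leq_mul2l leq_mul2r mk !orbT.
have kd : n <= k * delta.
  by move: F1' c0; clear; move: (k * delta) => X; nia.
have dlo : 4 * m * b * r <= delta.
  rewrite -(leq_pmul2l k0); apply: leq_trans kd; apply: leq_trans rn.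
  by apply: eq_leq; rewrite BgE; ring.
have bk : 100 * (k * k) <= b.
  have -> : b = 100 * (k * k) * (c * k) by rewrite bE; ring.
  by rewrite leq_pmulr // muln_gt0 c0.
have drk : 100 * k * (m * r) * 2 <= delta.
  apply: leq_trans dlo.
  have -> : 4 * m * b * r = b * (m * r) * 4 by ring.
  apply: leq_mul => //; rewrite leq_mul2r; apply/orP; right; apply: leq_trans bk.
  by rewrite leq_mul2l leq_pmulr.
have [|||I [C [Im CC exC cliq dense]]] :=
    @exists_structure k m c G a delta r k3 m0 mk c0 Ha Hd F1 _ _ _ ar.
- by apply: leq_trans rn; rewrite BgE bE.
- by apply: leq_trans nr _; apply: eq_leq; rewrite BgE bE; ring.
- by apply: leq_trans s_r; apply: leq_trans slo; rewrite r0E -addnA leq_addr.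
have hM : s * (z * (4 * k)) = s * M by rewrite ME.
have hr : s * M <= r.
  by apply: leq_trans sr; rewrite mulnC mulnC -mulnA [M * s]mulnC leq_pmull.
have mm : m ^ 2 * r <= k * (m * r) by rewrite -mulnn -mulnA leq_mul2r (ltnW mk) orbT.
have rkm : r <= k * (m * r) by rewrite mulnA leq_pmull // muln_gt0 k0.
(* Outside the cores and [W] there are so few vertices that every vertex keeps a quarter of [delta]
   as neighbours; with [n <= k * delta] this gives [p = 4 * k]. *)
have [|||X [XH cX Xbad]] := @hitting_set G (\bigcup_(i in I) C i) (4 * k) z s.
- by rewrite muln_gt0.
- by [].
- move=> u W Ws; set H := \bigcup_(i in I) C i.
  have lo : delta <= #|nbr u :&: (H :\: W)| + 8 * m ^ 2 * r + r.
    have h1 := leq_cardD (nbr u) (~: H); have h2 := leq_cardD (nbr u :\: ~: H) W.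
    have e : nbr u :\: ~: H :\: W = nbr u :&: (H :\: W) by rewrite [nbr u :\: _]setDE setCK setIDA.
    rewrite e in h2; have := Hd u; rewrite hM in Ws.
    by move: h1 h2 exC Ws hr; rewrite -/H; clear; lia.
  apply: leq_trans kd _; have -> x : 4 * k * x = k * (4 * x) by ring.
  rewrite leq_mul2l; apply/orP; right.
  move: lo mm rkm drk; rewrite -[8 * _ * r]mulnA -![100 * k * _]mulnA; clear.
  by move: (m ^ 2 * r) (k * (m * r)) => x y; lia.
rewrite hM in cX.
have h_pos : 0 < s * M by rewrite muln_gt0 s_pos.
(* A common bound for the terms of order [a]; the successor also covers the additive [k]. *)
pose Y := c * k ^ 3 * a.+1.
have Ys : 8 * Y <= s.
  rewrite -(@leq_pmul2l 2) //; have -> : 2 * (8 * Y) = q * a + q by rewrite /Y qE; ring.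
  by rewrite mul2n -addnn leq_add // (leq_trans _ slo) // leq_addl.
have Ypos : 0 < Y by rewrite muln_gt0 muln_gt0 c0 kk.
have kY : k <= Y.
  rewrite /Y -mulnA; apply: leq_trans (leq_pmull _ c0); apply: leq_trans (leq_pmulr _ _) => //.
  by rewrite -{1}(expn1 k) leq_pexp2l.
have kaY : m * ((k - 2) * a) <= Y.
  rewrite /Y -mulnA; apply: leq_trans (leq_pmull _ c0).
  rewrite mulnA; apply: leq_mul => //; apply: (@leq_trans (k ^ 2)); last by rewrite leq_pexp2l.
  by rewrite -mulnn; apply: leq_mul; [exact: ltnW|exact: leq_subr].
have EY : 2 * c * k * ((k - 2) * a + k) * k.-1 <= 2 * Y.
  have h1 : (k - 2) * a + k <= k * a.+1.
    by rewrite mulnS addnC leq_add2l leq_mul2r leq_subr orbT.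
  apply: leq_trans (leq_mul (leq_mul (leqnn _) h1) (leq_pred k)) _.
  by apply: eq_leq; rewrite /Y; ring.
have sM : s <= s * M by rewrite leq_pmulr.
(* [h = s * M] bounds the size of [X] after [s] rounds, [g] is [h / k], and [z] was chosen to make
   [Bad] at most [r / k]. *)
apply: (@assemble G k a k3 Ha m r t (4 * z * s) (s * M) s
  (2 * c * k * ((k - 2) * a + k)) delta I C X) => //.
- by rewrite !muln_gt0 z0.
- by rewrite ME; ring.
- apply: leq_trans (_ : A * (s * M) <= _); last by apply: leq_trans sr; apply: eq_leq; ring.
  have : k * t.+2 <= k * t.+2 * (s * M) by rewrite leq_pmulr.
  move: (s * M) (k * t.+2) AE TE => h K2 -> ->; clear; move: (k * t.+1) => T'.
  have -> : (8 + m * (5 + 4 * k + 153 * T') + 4 * k + 153 * T' + K2) * h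
    = h + m * (5 * h + 4 * h * k + 153 * h * T') + (7 * h + 4 * h * k + 153 * h * T') + K2 * h by ring.
  by lia.
- have : z * #|[set u | 2 * #|nbr u :&: X| < s]| <= 2 * (2 * (Bg * r)).
    by apply: leq_trans Xbad _; rewrite leq_mul2l.
  move: #|_| => x; have -> : z * x = (4 * Bg) * (x * k) by rewrite zE; ring.
  have -> : 2 * (2 * (Bg * r)) = (4 * Bg) * r by ring.
  by rewrite leq_pmul2l // muln_gt0.
- have h1 : (k - 2) * a <= k * (m * r).
    by apply: leq_mul; [exact: leq_subr|apply: leq_trans a_r _; rewrite leq_pmull].
  apply: leq_trans drk; move: rkm h1 r_pos; rewrite -mulnA -mulnA.
  by rewrite [m * r * 2]mulnC mulnCA; move: (k * (m * r)) => y; clear; lia.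
- move=> l' H; apply: (near_tiling_bound k3 c0 n0 F1' a_r _ H).
  apply: leq_trans rn; rewrite leq_mul2r -Bgc; apply/orP; right.
  have -> : 400 * (c * k ^ 4 * m) = 400 * c * k ^ 2 * (k ^ 2 * m) by ring.
  apply: leq_trans (leq_pmulr _ _); last by rewrite muln_gt0 expn_gt0 k0.
  by rewrite -!mulnA leq_mul.
- by move: EY kaY Ys Ypos; clear; lia.
- by move: EY kY Ys sM; clear; lia.
Qed.

(** * Transfer to the real parameters *)

Lemma min_degree_leq (G : sgraph) (x : G) : min_degree G <= #|nbr x|.
Proof.
rewrite /min_degree; have := mem_index_enum x.
elim: (index_enum G) => // y s IH; rewrite inE big_cons => /orP[/eqP->|/IH xs].
  exact: geq_minl.
exact: leq_trans (geq_minr _ _) xs.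
Qed.

Lemma leq_independence_number (G : sgraph) (A : {set G}) :
  independent A -> #|A| <= independence_number G.
Proof. by move=> iA; rewrite /independence_number (bigD1 A) //= leq_maxl. Qed.

Import Order.TTheory GRing.Theory Num.Theory.
Local Open Scope ring_scope.

Theorem theorem1p10 (R : realType) (k : nat) (eta : R) :
  (3 <= k)%N -> 1 / k%:R < eta -> eta <= 1 ->
  exists2 alpha : R, 0 < alpha &
    exists N : nat, forall n : nat, (N <= n)%N ->
      forall G : sgraph, #|G| = n ->
        eta * n%:R <= (min_degree G)%:R ->
        (independence_number G)%:R <= alpha * n%:R ->
        exists t : {set {ffun cycle_graph k -> G}},
          is_tiling t /\ quasiperfect eta t.
Proof.
move=> k3 eta_k eta1.
have kR : 0 < k%:R :> R by rewrite ltr0n; lia.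
have eta0 : 0 < eta by apply: lt_trans eta_k; rewrite divr_gt0.
have inv1 : 1 <= 1 / eta by rewrite ler_pdivlMr // mul1r.
have invk : 1 / eta < k%:R.
  by rewrite ltr_pdivrMr // mulrC -ltr_pdivrMr.
have [m fm] : exists m : nat, Num.floor (1 / eta) = m%:Z.
  have : 0 <= Num.floor (1 / eta) by rewrite floor_ge0; lra.
  by case: (Num.floor _) => // m _; exists m.
have m0 : (0 < m)%N.
  have : 1 <= Num.floor (1 / eta) by rewrite floor_ge_int.
  by rewrite fm; lia.
have mk : (m < k)%N.
  have : Num.floor (1 / eta) < k%:Z by rewrite floor_lt_int.
  by rewrite fm; lia.
have eta_m : 1 < m.+1%:R * eta.
  have := floorD1_gt (1 / eta); rewrite fm (_ : m%:Z + 1 = m.+1%:Z); last by lia.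
  by rewrite -pmulrn ltr_pdivrMr.
(* The floor gives only the strict inequality [(m + 1) * eta > 1]; the integer [c] turns it into the
   gap [1 / c] used over the naturals. *)
have [c c0 Hc] : exists2 c : nat, (0 < c)%N & 1 <= c%:R * (m.+1%:R * eta - 1).
  pose y : R := m.+1%:R * eta - 1.
  have y0 : 0 < y by rewrite /y subr_gt0.
  exists (Num.bound (y^-1)).
    by rewrite -(ltr_nat R); apply: le_lt_trans (archi_boundP _); rewrite invr_ge0 ltW.
  rewrite -/y -ler_pdivrMr // mul1r; apply: ltW; apply: archi_boundP.
  by rewrite invr_ge0 ltW.
have [K [N [K0 H]]] := quasi_tiling k3 m0 mk c0.
exists (1 / K%:R); first by rewrite divr_gt0 ?ltr0n.
exists N => n Nn G Gn dG iG.
have [|||||S tS cS] := H G (independence_number G) (min_degree G).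
- by rewrite Gn.
- exact: leq_independence_number.
- exact: min_degree_leq.
- rewrite Gn -(ler_nat R) !natrM -[c.+1%:R]natr1.
  have n0 : 0 <= n%:R :> R by rewrite ler0n.
  have h1 : c%:R * m.+1%:R * (eta * n%:R) <= c%:R * m.+1%:R * (min_degree G)%:R.
    by rewrite ler_wpM2l // mulr_ge0 ?ler0n.
  have h2 : 1 * n%:R <= c%:R * (m.+1%:R * eta - 1) * n%:R by rewrite ler_wpM2r.
  move: h1 h2; move: (min_degree G)%:R (c%:R) (m.+1%:R) (n%:R) => x y z v; nra.
- rewrite Gn -(ler_nat R) natrM mulrC -ler_pdivlMr ?ltr0n //.
  by apply: le_trans iG _; rewrite mul1r mulrC.
have [t tt ct] := tileable_tiling tS.
exists t; split=> //.
rewrite /quasiperfect ct fm card_ord.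
have -> : k%:Z - 1 = k.-1%:Z by clear -k3; lia.
by rewrite -PoszM lez_nat.
Qed.
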